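(* Let $S_{\mathbb{F}_5}$ be the smooth del Pezzo surface of degree $1$ over $\mathbb{F}_5$ that is the reduction modulo $5$ of the surface $$ S_{\mathbb{Q}}=\Big\{y^2=x^3+uv^2(3u-v)x+\frac14uv\bigl(4v^4-23uv^3-18u^2v^2+u^3v-4u^4\bigr)\Big\}\subset \mathbb{P}_{\mathbb{Q}}(1_u,1_v,2_x,3_y), $$ i.e. the surface in $\mathbb{P}_{\mathbb{F}_5}(1_u,1_v,2_x,3_y)$ given by the same equation with coefficients reduced modulo $5$. Then there is a dominant separable rational map $\mathbb{P}^2_{\mathbb{F}_5}\dashrightarrow S_{\mathbb{F}_5}$ of degree $9$ defined over $\mathbb{F}_5$.
   Context: $\mathbb{P}_{\Bbbk}(1_u,1_v,2_x,3_y)$ denotes the weighted projective space over the field $\Bbbk$ with homogeneous coordinates $u,v,x,y$ of weights $1,1,2,3$, respectively. A del Pezzo surface of degree $1$ over a field is a smooth projective geometrically integral surface $S$ with $-K_S$ ample and $(-K_S)^2=1$. In the reduction modulo $5$, $\frac14$ means the inverse of $4$ in $\mathbb{F}_5$. A dominant rational map between varieties of the same dimension is separable if the induced extension of function fields is separable. *)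

(* Defs.v *)
From HB Require Import structures.
From mathcomp Require Import all_boot all_order all_algebra.
From mathcomp Require Import separable.
From mathcomp Require Import mpoly ring.

Set Implicit Arguments.
Unset Strict Implicit.
Unset Printing Implicit Defensive.

Import GRing.Theory.
Local Open Scope ring_scope.

(* Varieties over k are described through their points with values in         *)
(* arbitrary field extensions iota : k -> L.  The points of the underlying    *)
(* topological space of a k-scheme are classes of such field-valued points,   *)
(* so generic points are included and no algebraic closure has to be chosen.  *)

(* The variables 'X_0, 'X_1, 'X_2, 'X_3 of {mpoly k[4]} are u, v, x, y. *)
Definition wt (i : 'I_4) : nat := nth 0%N [:: 1; 1; 2; 3]%N i.

Definition wdeg (m : 'X_{1..4}) : nat := (\sum_(i < 4) wt i * m i)%N.

Fact wdeg0 : wdeg 0%MM = 0%N.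
Proof. by rewrite /wdeg big1 // => i _; rewrite mnm0E muln0. Qed.

Fact wdegD : {morph wdeg : m1 m2 / (m1 + m2)%MM >-> (m1 + m2)%N}.
Proof.
move=> m1 m2; rewrite /wdeg -big_split /=.
by apply: eq_bigr => i _; rewrite mnmDE mulnDr.
Qed.

HB.instance Definition _ := isMeasure.Build 4 wdeg wdeg0 wdegD.

Section WeightedProjectiveSpace.

Variable k : fieldType.

(* q is a vector of homogeneous coordinates of a point of {F = 0}.  Neither   *)
(* condition depends on the choice of coordinates when F is weighted          *)
(* homogeneous, hence points need not be taken modulo rescaling.              *)
Definition on_surface (F : {mpoly k[4]}) (L : fieldType)
    (iota : {rmorphism k -> L}) (q : 'I_4 -> L) : Prop :=
  (exists i, q i != 0) /\ mmap iota q F = 0.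

Definition vanishes_on (F G : {mpoly k[4]}) : Prop :=
  forall (L : fieldType) (iota : {rmorphism k -> L}) (q : 'I_4 -> L),
    on_surface F iota q -> mmap iota q G = 0.

(* The weighted homogeneous polynomial F cuts out a smooth surface: the       *)
(* surface avoids the points of P(1,1,2,3) with nontrivial stabilizer, i.e.   *)
(* (0:0:1:0) and (0:0:0:1), and satisfies the Jacobian criterion elsewhere.   *)
Definition smooth_surface (F : {mpoly k[4]}) : Prop :=
  forall (L : fieldType) (iota : {rmorphism k -> L}) (q : 'I_4 -> L),
    on_surface F iota q ->
    [|| q 0 != 0, q 1 != 0 | (q 2 != 0) && (q 3 != 0)]
    /\ exists i, mmap iota q (F^`M(i)) != 0.

(* Del Pezzo surfaces of degree 1 are exactly the smooth sextics S in         *)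
(* P(1,1,2,3): by adjunction K_S = O_S(6 - (1 + 1 + 2 + 3)) = O_S(-1), and    *)
(* O_S(1)^2 = 6 / (1 * 1 * 2 * 3) = 1.                                        *)
Record delPezzo1 := DelPezzo1 {
  dP1_eqn :> {mpoly k[4]};
  dP1_homog : dP1_eqn \is 6.-homog for wdeg;
  dP1_smooth : smooth_surface dP1_eqn }.

End WeightedProjectiveSpace.

Section RationalMaps.

Variables (k : fieldType) (S : delPezzo1 k).

(* A rational map P^2 --> S, given by homogeneous polynomials of degrees      *)
(* e, e, 2e, 3e, not all zero, which satisfy the equation of S.  Every        *)
(* rational map has such a representative (clear denominators).               *)
Record ratmap := RatMap {
  rm_deg : nat;
  rm_poly : 4.-tuple {mpoly k[3]};
  rm_homog : forall i, tnth rm_poly i \is (rm_deg * wt i).-homog;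
  rm_neq0 : exists i, tnth rm_poly i != 0;
  rm_on : dP1_eqn S \mPo rm_poly = 0 }.

Implicit Type phi : ratmap.

Definition rm_eval phi (L : fieldType) (iota : {rmorphism k -> L})
    (p : 'I_3 -> L) : 'I_4 -> L :=
  fun i => mmap iota p (tnth (rm_poly phi) i).

(* The image of phi lies in the closed set {G = 0}.  Restricting to the open  *)
(* dense set on which the given representative is defined is harmless.        *)
Definition image_in phi (G : {mpoly k[4]}) : Prop :=
  forall (L : fieldType) (iota : {rmorphism k -> L}) (p : 'I_3 -> L),
    (exists j, p j != 0) -> (exists i, rm_eval phi iota p i != 0) ->
    mmap iota (rm_eval phi iota p) G = 0.

Definition dominant phi : Prop :=
  forall d G, G \is d.-homog for wdeg -> image_in phi G -> vanishes_on S G.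

(* k(P^2), as the set of fractions of degree 0 in Frac k[X_0, X_1, X_2]. *)
Definition funfield_P2 (z : {fraction {mpoly k[3]}}) : Prop :=
  exists (d : nat) (A B : {mpoly k[3]}),
    [/\ A \is d.-homog, B \is d.-homog, B != 0
      & z = FracField.tofrac A / FracField.tofrac B].

(* phi^* k(S) inside k(P^2): the pullbacks of the rational functions G / H on *)
(* S, with G and H homogeneous of the same degree and H not zero on S.        *)
Definition funfield_pullback phi (z : {fraction {mpoly k[3]}}) : Prop :=
  exists (d : nat) (G H : {mpoly k[4]}),
    [/\ G \is d.-homog for wdeg, H \is d.-homog for wdeg, ~ vanishes_on S H
      & z = FracField.tofrac (G \mPo rm_poly phi)
            / FracField.tofrac (H \mPo rm_poly phi)].

End RationalMaps.

(* Field extensions K0 <= K inside an ambient field E.  The fields of         *)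
(* interest are not finite-dimensional over the prime field, so that          *)
(* {subfield E} does not apply.                                               *)
Section Extensions.

Variable E : fieldType.

Definition ext_degree (K0 K : E -> Prop) (n : nat) : Prop :=
  exists b : 'I_n -> E, (forall i, K (b i)) /\
    forall z, K z -> exists! c : {ffun 'I_n -> E},
      (forall i, K0 (c i)) /\ z = \sum_i c i * b i.

Definition is_minPoly (K0 : E -> Prop) (z : E) (p : {poly E}) : Prop :=
  [/\ p \is monic, forall i, K0 p`_i, root p z
    & forall q : {poly E}, (forall i, K0 q`_i) -> q != 0 -> root q z ->
        (size p <= size q)%N].

Definition ext_separable (K0 K : E -> Prop) : Prop :=
  forall z, K z -> exists2 p, is_minPoly K0 z p & separable_poly p.

End Extensions.

Definition ratmap_degree (k : fieldType) (S : delPezzo1 k) (phi : ratmap S)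
    (n : nat) : Prop :=
  ext_degree (funfield_pullback phi) (@funfield_P2 k) n.

Definition ratmap_separable (k : fieldType) (S : delPezzo1 k)
    (phi : ratmap S) : Prop :=
  ext_separable (funfield_pullback phi) (@funfield_P2 k).

(* The equation defines S_Q for k = rat, and its reduction modulo 5 for       *)
(* k = 'F_5; in both cases 4^-1 is the inverse of 4 in k.                     *)
Definition sextic (k : fieldType) : {mpoly k[4]} :=
  let u := 'X_0 in let v := 'X_1 in let x := 'X_2 in let y := 'X_3 in
  y ^+ 2 - (x ^+ 3 + u * v ^+ 2 * (3 * u - v) * x
    + 4^-1 *: (u * v * (4 * v ^+ 4 - 23 * u * v ^+ 3 - 18 * u ^+ 2 * v ^+ 2
                        + u ^+ 3 * v - 4 * u ^+ 4))).

Lemma sextic_homog (k : fieldType) : sextic k \is 6.-homog for wdeg.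
Proof.
have hX i : ('X_i : {mpoly k[4]}) \is (wt i).-homog for wdeg.
  rewrite dhomogX /= /wdeg (bigD1 i) //= big1 ?addn0 => [|j /negPf ne].
    by rewrite mnm1E eqxx muln1.
  by rewrite mnm1E eq_sym ne muln0.
have hn (n : nat) : (n%:R : {mpoly k[4]}) \is 0.-homog for wdeg.
  by rewrite -scaler_nat; apply/dhomogZ/dhomog1.
have hM (d e f : nat) (p q : {mpoly k[4]}) : (d + e == f)%N ->
    p \is d.-homog for wdeg -> q \is e.-homog for wdeg ->
    p * q \is f.-homog for wdeg.
  by move=> /eqP <-; apply: dhomogM.
have hE (n d e : nat) (p : {mpoly k[4]}) : (d * n == e)%N ->
    p \is d.-homog for wdeg -> p ^+ n \is e.-homog for wdeg.
  by move=> /eqP <-; apply: dhomogMn.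
have u1 := hX 0; have v1 := hX 1; have x2 := hX 2; have y3 := hX 3.
have hZ c d (p : {mpoly k[4]}) : p \is d.-homog for wdeg ->
    c *: p \is d.-homog for wdeg by apply: dhomogZ.
rewrite /sextic; move: u1 v1 x2 y3; rewrite /wt /=.
set u := 'X_0; set v := 'X_1; set x := 'X_2; set y := 'X_3 => u1 v1 x2 y3.
have u2 := hE 2%N 1%N 2%N u isT u1; have u3 := hE 3%N 1%N 3%N u isT u1.
have u4 := hE 4%N 1%N 4%N u isT u1; have v2 := hE 2%N 1%N 2%N v isT v1.
have v3 := hE 3%N 1%N 3%N v isT v1; have v4 := hE 4%N 1%N 4%N v isT v1.
have a4 : u * v ^+ 2 * (3 * u - v) \is 4.-homog for wdeg.
  apply: (hM 3%N 1%N 4%N _ _ isT); first exact: (hM 1%N 2%N 3%N _ _ isT).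
  by apply: rpredB => //; exact: (hM 0%N 1%N 1%N _ _ isT).
apply: rpredB; first exact: (hE 2%N 3%N).
apply: rpredD.
  by apply: rpredD; [exact: (hE 3%N 2%N) | exact: (hM 4%N 2%N)].
apply/hZ/(hM 2%N 4%N) => //; first exact: (hM 1%N 1%N).
apply: rpredB; last exact: (hM 0%N 4%N).
apply: rpredD; last exact: (hM 3%N 1%N).
apply: rpredB; last by apply: (hM 2%N 2%N) => //; apply: (hM 0%N 2%N).
apply: rpredB; first exact: (hM 0%N 4%N).
by apply: (hM 1%N 3%N) => //; apply: (hM 0%N 1%N).
Qed.

(* The computation behind sextic_F5_smooth, with evaluation e and its         *)
(* derivatives D kept abstract: powers of u, v and x lie in the ideal         *)
(* generated by the partial derivatives modulo 5.                             *)
Lemma sextic_F5_singular (P : comNzRingType) (L : fieldType) (X : 'I_4 -> P)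
    (c : P) (q : 'I_4 -> L) (e : P -> L) (D : 'I_4 -> P -> L) :
  5 = 0 :> L ->
  e c = - 1 -> (forall i, e (X i) = q i) -> (forall n : nat, e n%:R = n%:R) ->
  (forall p r, e (p - r) = e p - e r) -> (forall p r, e (p + r) = e p + e r) ->
  (forall p r, e (p * r) = e p * e r) ->
  (forall p n, e (p ^+ n) = e p ^+ n) ->
  (forall j, D j c = 0) -> (forall j i, D j (X i) = (i == j)%:R) ->
  (forall j (n : nat), D j n%:R = 0) ->
  (forall j p r, D j (p - r) = D j p - D j r) ->
  (forall j p r, D j (p + r) = D j p + D j r) ->
  (forall j p r, D j (p * r) = D j p * e r + e p * D j r) ->
  (forall j p n, D j (p ^+ n) = n%:R * e p ^+ n.-1 * D j p) ->
  let u := X 0 in let v := X 1 in let x := X 2 in let y := X 3 in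
  let F := y ^+ 2 - (x ^+ 3 + u * v ^+ 2 * (3 * u - v) * x
    + c * (u * v * (4 * v ^+ 4 - 23 * u * v ^+ 3 - 18 * u ^+ 2 * v ^+ 2
                        + u ^+ 3 * v - 4 * u ^+ 4))) in
  (q 0 = 0 -> q 1 = 0 -> e F = 0 -> q 3 ^+ 2 = q 2 ^+ 3) /\
  ((forall j, D j F = 0) -> forall i, q i = 0).
Proof.
move=> p5 ec eX en eB eD eM eE Dc DX Dn DB DD DM DE /=.
have eR := (eB, eD, eM, eE, eX, en, ec).
have nilp (z : L) n : z ^+ n = 0 -> z = 0.
  by move/eqP; rewrite expf_eq0 => /andP[_ /eqP].
split.
  rewrite !eR => -> ->; rewrite !(mul0r, mulr0, addr0) => /eqP.
  by rewrite subr_eq0 => /eqP.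
set u := X 0; set v := X 1; set x := X 2; set y := X 3; set F := _ - _ => H.
have DF j : D j F = (3 == j)%:R * (2 * q 3)
    - (2 == j)%:R * (3 * q 2 ^+ 2 + 3 * q 0 ^+ 2 * q 1 ^+ 2 - q 0 * q 1 ^+ 3)
    - (0 == j)%:R * (6 * q 0 * q 1 ^+ 2 * q 2 - q 1 ^+ 3 * q 2 - 4 * q 1 ^+ 5
        + 46 * q 0 * q 1 ^+ 4 + 54 * q 0 ^+ 2 * q 1 ^+ 3
        - 4 * q 0 ^+ 3 * q 1 ^+ 2 + 20 * q 0 ^+ 4 * q 1)
    - (1 == j)%:R * (6 * q 0 ^+ 2 * q 1 * q 2 - 3 * q 0 * q 1 ^+ 2 * q 2
        - 20 * q 0 * q 1 ^+ 4 + 92 * q 0 ^+ 2 * q 1 ^+ 3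
        + 54 * q 0 ^+ 3 * q 1 ^+ 2 - 2 * q 0 ^+ 4 * q 1 + 4 * q 0 ^+ 5).
  by rewrite /F !(DB, DD, DM, DE, DX, Dn, Dc, eR) /=; ring.
have Hy := H 3; have Hx := H 2; have Hv := H 1; have Hu := H 0.
move: Hy Hx Hv Hu; rewrite !DF /= !(mul0r, mul1r, subr0, sub0r).
move=> {F H DF u v x y} Hy.
move/eqP; rewrite oppr_eq0 => /eqP Hx; move/eqP; rewrite oppr_eq0 => /eqP Hv.
move/eqP; rewrite oppr_eq0 => /eqP Hu.
move: Hy Hx Hv Hu.
set u := q 0; set v := q 1; set x := q 2; set y := q 3.
set fx := 3 * x ^+ 2 + _ - _; set fv := _ + 4 * u ^+ 5.
set fu := _ + 20 * u ^+ 4 * v => Hy Hx Hv Hu.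
have u0 : u = 0.
  apply: (@nilp u 11%N).
  pose W :=
    u ^+ 11 + u * v ^+ 6 * x ^+ 2 + 60 * u ^+ 3 * v ^+ 8
    + 9 * u ^+ 2 * v ^+ 9 - 5 * u ^+ 2 * v ^+ 5 * x ^+ 2
    + 73 * u ^+ 4 * v ^+ 7 - u ^+ 3 * v ^+ 4 * x ^+ 2 + 63 * u ^+ 5 * v ^+ 6
    - u ^+ 4 * v ^+ 3 * x ^+ 2 + 87 * u ^+ 6 * v ^+ 5
    - 57 * u ^+ 3 * v ^+ 6 * x - 54 * u ^+ 2 * v ^+ 7 * x
    - 29 * u ^+ 4 * v ^+ 5 * x - 20 * u ^+ 7 * v ^+ 4
    - 7 * u ^+ 5 * v ^+ 4 * x - 18 * u ^+ 8 * v ^+ 3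
    - 2 * u ^+ 6 * v ^+ 3 * x + 22 * u ^+ 9 * v ^+ 2
    - 9 * u ^+ 7 * v ^+ 2 * x - 10 * u ^+ 10 * v + 9 * u * v ^+ 8 * x
    - 2 * u ^+ 8 * v * x - 4 * u * v ^+ 10.
  transitivity (
    (u * v ^+ 6 + u ^+ 2 * v ^+ 5 - 2 * u ^+ 3 * v ^+ 4 - u ^+ 4 * v ^+ 3) * fx
    + (- 2 * u ^+ 2 * v ^+ 4 - 2 * u ^+ 3 * v ^+ 3 - 2 * u ^+ 4 * v ^+ 2
       - 2 * u ^+ 5 * v + 2 * u ^+ 6 + 2 * u * v ^+ 3 * x
       + 2 * u ^+ 2 * v ^+ 2 * x + u ^+ 3 * v * x + u ^+ 4 * x) * fu
    + (- v ^+ 6 - 2 * u * v ^+ 5 - u ^+ 2 * v ^+ 4 - u ^+ 3 * v ^+ 3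
       - u ^+ 4 * v ^+ 2 + 2 * u ^+ 5 * v - u ^+ 6 + 2 * v ^+ 4 * x
       - u ^+ 3 * v * x) * fv
    + 5 * W);
    last by rewrite Hx Hu Hv p5; ring.
  by rewrite /W /fx /fu /fv; ring.
have v0 : v = 0.
  apply: (@nilp v 9%N).
  pose W :=
    v ^+ 9 - v ^+ 5 * x ^+ 2 + 6 * u ^+ 2 * v ^+ 7 - 12 * u * v ^+ 8
    - 2 * u ^+ 2 * v ^+ 3 * x ^+ 2 - 11 * u ^+ 4 * v ^+ 5
    - 52 * u ^+ 3 * v ^+ 6 - 3 * u ^+ 3 * v ^+ 2 * x ^+ 2
    + 27 * u ^+ 5 * v ^+ 4 - 10 * u * v ^+ 6 * x + v ^+ 7 * x
    - 17 * u ^+ 2 * v ^+ 5 * x - 33 * u ^+ 3 * v ^+ 4 * x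
    + 16 * u ^+ 6 * v ^+ 3 - 24 * u ^+ 4 * v ^+ 3 * x - 4 * u ^+ 7 * v ^+ 2
    + 8 * u ^+ 8 * v - u * v ^+ 4 * x ^+ 2 - 8 * u ^+ 6 * v * x.
  transitivity (
    (2 * v ^+ 5 + 2 * u ^+ 2 * v ^+ 3 + u ^+ 3 * v ^+ 2) * fx
    + (v ^+ 4 + u * v ^+ 3 + u ^+ 2 * v ^+ 2 + u ^+ 3 * v - 2 * u ^+ 4
       + v ^+ 2 * x + u * v * x + 2 * u ^+ 2 * x) * fu
    + (- v ^+ 4 + 2 * u * v ^+ 3 - 2 * u ^+ 2 * v ^+ 2) * fv
    + 5 * W);
    last by rewrite Hx Hu Hv p5; ring.
  by rewrite /W /fx /fu /fv; ring.
have x0 : x = 0.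
  apply: (@nilp x 6%N).
  pose W :=
    - x ^+ 6 - u * v ^+ 7 * x ^+ 2 + 7 * u ^+ 3 * v ^+ 9
    - 19 * u ^+ 2 * v ^+ 10 + u ^+ 2 * v ^+ 6 * x ^+ 2
    - 45 * u ^+ 4 * v ^+ 8 + u ^+ 3 * v ^+ 5 * x ^+ 2 + 9 * u ^+ 5 * v ^+ 7
    + 54 * u ^+ 6 * v ^+ 6 + 14 * u ^+ 7 * v ^+ 5 + u * v ^+ 3 * x ^+ 4
    + 25 * u ^+ 3 * v ^+ 7 * x + 17 * u ^+ 2 * v ^+ 8 * x
    - 15 * u ^+ 4 * v ^+ 6 * x - 9 * u ^+ 5 * v ^+ 5 * x
    + 16 * u ^+ 8 * v ^+ 4 - 2 * u ^+ 7 * v ^+ 3 * x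
    - 9 * u ^+ 6 * v ^+ 4 * x + 4 * u ^+ 10 * v ^+ 2 - u * v ^+ 9 * x
    - u ^+ 4 * v ^+ 4 * x ^+ 2 - 4 * u ^+ 8 * v ^+ 2 * x + 4 * u * v ^+ 11.
  transitivity (
    (u * v ^+ 7 + 2 * u ^+ 2 * v ^+ 6 - u ^+ 3 * v ^+ 5
       + 2 * u ^+ 4 * v ^+ 4 - 2 * u ^+ 5 * v ^+ 3 - u * v ^+ 3 * x ^+ 2
       - 2 * u ^+ 2 * v ^+ 2 * x ^+ 2 + 2 * x ^+ 4) * fx
    + (- u ^+ 2 * v ^+ 5 + u ^+ 3 * v ^+ 4 - u ^+ 4 * v ^+ 3 - u ^+ 6 * v
       - 2 * u * v ^+ 4 * x + u ^+ 3 * v ^+ 2 * x + u ^+ 4 * v * x) * fu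
    + (v ^+ 7 + 2 * u ^+ 2 * v ^+ 5 - 2 * u ^+ 3 * v ^+ 4 - u ^+ 4 * v ^+ 3) * fv
    + 5 * W);
    last by rewrite Hx Hu Hv p5; ring.
  by rewrite /W /fx /fu /fv; ring.
have y0 : y = 0.
  have -> : y = 5 * y - 2 * (2 * y) by ring.
  by rewrite p5 Hy; ring.
move=> [[|[|[|[|//]]]] lti]; [rewrite -u0|rewrite -v0|rewrite -x0|rewrite -y0];
  by congr (q _); apply: val_inj.
Qed.

Lemma sextic_F5_smooth : smooth_surface (sextic 'F_5).
Proof.
move=> L iota q [[i0 qi0] Fq].
have p5 : 5 = 0 :> L.
  by rewrite -(rmorph_nat iota 5); apply/eqP; rewrite fmorph_eq0.
pose e : {mpoly 'F_5[4]} -> L := mmap iota q.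
pose D j (p : {mpoly 'F_5[4]}) : L := mmap iota q (p^`M(j)).
have ec : e (4^-1)%:MP = - 1.
  rewrite /e mmapC -(rmorphN1 iota); congr (iota _); exact/eqP.
have eX i : e 'X_i = q i by rewrite /e mmapX mmap1U.
have en (n : nat) : e n%:R = n%:R by exact: rmorph_nat.
have eB p r : e (p - r) = e p - e r by exact: rmorphB.
have eD p r : e (p + r) = e p + e r by exact: rmorphD.
have eM p r : e (p * r) = e p * e r by exact: rmorphM.
have eE p n : e (p ^+ n) = e p ^+ n by exact: rmorphXn.
have Dc j : D j (4^-1)%:MP = 0.
  by rewrite /D mderivC; exact: (en 0%N).
have DX j i : D j 'X_i = (i == j)%:R.
  rewrite /D mderivX mnm1E; case: eqP => [->|_].
    rewrite scale1r -[X in (X - _)%MM]add0m addmK mpolyX0; exact: (en 1%N).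
  by rewrite scale0r; exact: (en 0%N).
have Dn j (n : nat) : D j n%:R = 0.
  by rewrite /D -mpolyC_nat mderivC; exact: (en 0%N).
have DB j p r : D j (p - r) = D j p - D j r by rewrite /D mderivB; exact: eB.
have DD j p r : D j (p + r) = D j p + D j r by rewrite /D mderivD; exact: eD.
have DM j p r : D j (p * r) = D j p * e r + e p * D j r.
  by rewrite /D mderivM -!eM; exact: eD.
have DE j p n : D j (p ^+ n) = n%:R * e p ^+ n.-1 * D j p.
  elim: n => [|n IHn]; first by rewrite expr0 (Dn j 1%N) !mul0r.
  rewrite exprS DM eE IHn /=; case: n {IHn} => [|n] /=.
    by rewrite !mul0r mulr0 addr0 mul1r mulrC.
  by rewrite -[n.+2%:R]natr1 exprS; ring.
have [] := sextic_F5_singular p5 ec eX en eB eD eM eE Dc DX Dn DB DD DM DE.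
rewrite mul_mpolyC -/(sextic 'F_5) => onF singF; split.
  case: (eqVneq (q 0) 0) (eqVneq (q 1) 0) => //= u0 [] //= v0.
  have {onF} xy := onF u0 v0 Fq.
  have xy0 : (q 2 == 0) = (q 3 == 0).
    by rewrite -[LHS]andTb -(expf_eq0 _ 3) -xy expf_eq0.
  rewrite xy0 andbb; apply: contra qi0 => y0.
  have /eqP x0 : q 2 == 0 by rewrite xy0.
  move/eqP: y0 => y0; apply/eqP; case: i0 => [[|[|[|[|//]]]] lti];
    [rewrite -u0|rewrite -v0|rewrite -x0|rewrite -y0];
    by congr (q _); apply: val_inj.
apply/existsP; apply: contraT; rewrite negb_exists => /forallP H.
case/eqP: qi0; apply: singF => j.
by apply/eqP; move: (H j); rewrite negbK.
Qed.

Definition S_F5 : delPezzo1 'F_5 :=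
  DelPezzo1 (sextic_homog 'F_5) sextic_F5_smooth.

(* Main.v *)
From Stdlib Require Import ZArith Classical ClassicalEpsilon.
From Stdlib Require Import FunctionalExtensionality PropExtensionality.
From HB Require Import structures.
From mathcomp Require Import all_boot all_order all_algebra.
From mathcomp Require Import separable.
From mathcomp Require Import qpoly mpoly ring zify.
Require Import Defs.

(** The anticanonical pencil of a del Pezzo surface S of degree 1 makes S, blown
    up at one point, an elliptic surface with parameter u / v.  A smooth plane
    cubic C maps to its Jacobian by sending p to 3 p minus a line section; this
    map has degree 9, because multiplication by 3 has, and the fibre over the
    origin consists of the nine flexes of C.  It therefore suffices to realise
    the Jacobian fibration S as that of a pencil of plane cubics: the members
    of a pencil sweep out the plane, a general point lying on exactly one of
    them, and the maps from the members to their Jacobians glue to a rational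
    map from the plane to S of degree 9.  It is separable because the
    characteristic 5 does not divide 9.

    Invariant theory writes the map from a cubic F = 0 to its Jacobian through
    three covariants: the Hessian H, the covariant Theta obtained by bordering
    the Hessian matrix with the gradient of H, and the Jacobian determinant J
    of F, H, Theta.  On the curve they satisfy J^2 = -4 Theta^3 + A Theta H^4
    + B H^6 with A, B invariants of F ([covariant_syzygy]), so X = Theta / H^2
    and Y = J / H^3 are coordinates on a Weierstrass model.  The pencil
      x^3 + s w^3 = y^2 ((2 s - 3) x - 2 w + s y)
    is the one whose Weierstrass model is S, with u / v = 3 s.  As s enters
    linearly, s is a quotient of two cubic forms; substituting it gives forms
    of degrees 15, 15, 30, 45 satisfying the sextic equation ([cover_sextic]).

    The degree is computed by hand.  Let x, w be affine coordinates on the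
    plane and let surface_ring be k[s, X] + Y k[s, X], whose fractions are the
    functions on S.  The functions 1, X, Y, X^2, X Y, and so on have poles of
    orders 0, 2, 3, 4, 5, and so on along the flexes H = 0.

    The powers 1, w, ..., w^8 are independent over surface_ring
    ([ev_surface_free], [powers_free]).  In a relation one may specialise s to
    1, after dividing by a power of s - 1; on that member, a cubic whose nine
    flexes have distinct values of w, the coefficient of the highest pole is a
    combination of 1, ..., w^8 that vanishes at all flexes, hence is zero
    ([fibre_free]).

    Any ten functions on the plane are dependent over surface_ring
    ([plane_dependent]).  Multiply the ten functions by the elements of pole
    order at most m with coefficients of degree at most L in s; after clearing
    H^m the products lie in a space of dimension about 9 m L, because the line
    sections of a cubic have degree 3 and H^m has degree 3 m, whereas there are
    about 10 m L products.

    Degree 9 follows.  The minimal polynomial of an inseparable element would be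
    one in the fifth power of the variable, of degree at most 9, hence of degree
    5; since 5 < 9 < 10, this contradicts one of the two bounds
    ([ext_separable_of_free]).  Dominance is again the independence statement:
    a form vanishing on the image gives a relation P(s, X) + Y Q(s, X) = 0,
    which must be trivial ([cover_vanish]). *)

Set Implicit Arguments.
Unset Strict Implicit.
Unset Printing Implicit Defensive.

Import GRing.Theory.
Local Open Scope ring_scope.

(** * Fields of fractions, degree and separability *)

(** Over a field, fewer spanning elements than listed ones force a relation:
    the matrix of coordinates has a nonzero row in its kernel. *)
Lemma dependent_of_span (k : fieldType) (E : comNzRingType)
    (j : {rmorphism k -> E}) (I I' : finType) (e : I -> E) (b : I' -> E) :
  (forall i, exists v : I' -> k, e i = \sum_i' j (v i') * b i') ->
  (#|I'| < #|I|)%N ->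
  exists c : I -> k, (exists i, c i != 0) /\ \sum_i j (c i) * e i = 0.
Proof.
move=> /fin_all_exists[v ev] ltI.
pose M := \matrix_(p < #|I|, q < #|I'|) v (enum_val p) (enum_val q).
have /matrix0Pn[r [q rq0]] : kermx M != 0.
  rewrite -mxrank_eq0 -lt0n mxrank_ker subn_gt0.
  exact: leq_ltn_trans (rank_leq_col M) ltI.
have rM : row r (kermx M) *m M = 0 by rewrite -row_mul mulmx_ker row0.
pose c i := kermx M r (enum_rank i).
exists c; split; first by exists (enum_val q); rewrite /c enum_valK.
under eq_bigr => i _ do rewrite ev mulr_sumr.
rewrite exchange_big big1 //= => i' _.
under eq_bigr => i _ do rewrite mulrA -rmorphM.
rewrite -mulr_suml -rmorph_sum /=; set z := \sum_i _; suff -> : z = 0.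
  by rewrite rmorph0 mul0r.
have := congr1 (fun N : 'rV_#|I'| => N 0 (enum_rank i')) rM.
rewrite !mxE => <-; rewrite /z (reindex_onto enum_val enum_rank) /=; last first.
  by move=> i _; rewrite enum_rankK.
under eq_bigl => p do rewrite enum_valK eqxx.
by apply: eq_bigr => p _; rewrite [row _ _ _ _]mxE [M _ _]mxE /c enum_valK enum_rankK.
Qed.

Section FractionsOf.

Variables (E : fieldType) (A : E -> Prop).
Hypotheses (A1 : A 1) (AB : forall x y, A x -> A y -> A (x - y))
  (AM : forall x y, A x -> A y -> A (x * y)).

Definition fraction_of (z : E) : Prop :=
  exists a b, [/\ A a, A b, b != 0 & z = a / b].

Lemma fraction_of_sub a : A a -> fraction_of a.
Proof. by exists a, 1; rewrite oner_neq0 divr1. Qed.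

Lemma fraction_ofB y z : fraction_of y -> fraction_of z -> fraction_of (y - z).
Proof.
move=> [a [b [Aa Ab b0 ->]]] [c [d [Ac Ad d0 ->]]].
exists (a * d - c * b), (b * d); split; rewrite ?mulf_neq0 //.
- by apply: AB; apply: AM.
- exact: AM.
- by field; rewrite b0 d0.
Qed.

Lemma fraction_ofV y z : fraction_of y -> fraction_of z -> fraction_of (y / z).
Proof.
move=> [a [b [Aa Ab b0 ->]]] [c [d [Ac Ad d0 ->]]].
have [->|c0] := eqVneq c 0.
  rewrite mul0r invr0 mulr0; apply: fraction_of_sub.
  by rewrite -(subrr 1); apply: AB.
exists (a * d), (b * c); split; rewrite ?mulf_neq0 //; try exact: AM.
by field; rewrite b0 c0 d0.
Qed.

Lemma fraction_ofM y z : fraction_of y -> fraction_of z -> fraction_of (y * z).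
Proof.
move=> [a [b [Aa Ab b0 ->]]] [c [d [Ac Ad d0 ->]]].
exists (a * c), (b * d); split; rewrite ?mulf_neq0 //; try exact: AM.
by field; rewrite b0 d0.
Qed.

Lemma common_denominator n (c : 'I_n -> E) : (forall i, fraction_of (c i)) ->
  exists b, [/\ A b, b != 0 & forall i, A (b * c i)].
Proof.
elim: n c => [|n IH] c Kc.
  by exists 1; split; rewrite ?oner_neq0 //; case.
have [b [Ab b0 bc]] := IH _ (fun i => Kc (lift ord0 i)).
have [a [d [Aa Ad d0 cE]]] := Kc ord0.
exists (b * d); split; rewrite ?mulf_neq0 //; first exact: AM.
move=> i; case: (unliftP ord0 i) => [k ->|->].
  by rewrite mulrAC; apply: AM.
by rewrite cE -mulrA [d * _]mulrC divfK //; apply: AM.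
Qed.

End FractionsOf.

(** A predicate closed under the field operations is turned into a field, over
    which Euclidean division of polynomials is available. *)
Section SubfieldType.

Variables (E : fieldType) (P : E -> Prop).
Hypotheses (P1 : P 1) (PB : forall x y, P x -> P y -> P (x - y))
  (PV : forall x y, P x -> P y -> P (x / y)).

Definition memP : {pred E} :=
  fun z => if excluded_middle_informative (P z) then true else false.

Lemma memPP z : reflect (P z) (z \in memP).
Proof.
by rewrite unfold_in /memP; case: excluded_middle_informative; constructor.
Qed.

Fact memP_divring_closed : divring_closed memP.
Proof.
split=> [|x y /memPP Px /memPP Py|x y /memPP Px /memPP Py]; apply/memPP => //.
- exact: PB.
- exact: PV.
Qed.

HB.instance Definition _ :=
  GRing.isDivringClosed.Build E memP memP_divring_closed.

Record subfieldP := SubfieldP { subfieldP_val : E; _ : subfieldP_val \in memP }.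
HB.instance Definition _ := [isSub for subfieldP_val].
HB.instance Definition _ := [Choice of subfieldP by <:].
HB.instance Definition _ := [SubChoice_isSubIntegralDomain of subfieldP by <:].
HB.instance Definition _ := [SubIntegralDomain_isSubField of subfieldP by <:].

Lemma subfield_rmorphism :
  exists (F0 : fieldType) (j : {rmorphism F0 -> E}),
    forall z, P z <-> exists a, z = j a.
Proof.
exists subfieldP, (val : {rmorphism _ -> _}) => z; split=> [/memPP Pz|[a ->]].
  by exists (SubfieldP Pz).
exact/memPP/(valP a).
Qed.

End SubfieldType.

Section DegreeCriterion.

Variables (E : fieldType) (K0 K : E -> Prop) (n : nat) (b : 'I_n -> E).
Hypotheses (K0_1 : K0 1) (K0_B : forall x y, K0 x -> K0 y -> K0 (x - y))
  (K0_V : forall x y, K0 x -> K0 y -> K0 (x / y)).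
Hypotheses (K_1 : K 1) (K_M : forall x y, K x -> K y -> K (x * y)).
Hypothesis Kb : forall i, K (b i).
Hypothesis b_free : forall c : 'I_n -> E, (forall i, K0 (c i)) ->
  \sum_i c i * b i = 0 -> forall i, c i = 0.
Hypothesis K_dep : forall g : 'I_n.+1 -> E, (forall i, K (g i)) ->
  exists c : 'I_n.+1 -> E, [/\ forall i, K0 (c i), exists i, c i != 0
    & \sum_i c i * g i = 0].

Let K0_N x : K0 x -> K0 (- x).
Proof. by move=> Kx; rewrite -sub0r -(subrr 1); do 2?apply: (K0_B). Qed.

Lemma ext_degree_of_free : ext_degree K0 K n.
Proof.
exists b; split=> // z Kz.
pose g (i : 'I_n.+1) := if unlift ord_max i is Some i' then b i' else z.
have gb i : g (lift ord_max i) = b i by rewrite /g liftK.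
have gz : g ord_max = z by rewrite /g unlift_none.
have [|c [c0 [i1 ci1] sumc]] := K_dep (g := g).
  by move=> i; rewrite /g; case: unliftP.
have sumE : \sum_(i < n.+1) c i * g i
  = c ord_max * z + \sum_(i < n) c (lift ord_max i) * b i.
  rewrite big_ord_recr /= gz addrC; congr (_ + _); apply: eq_bigr => i _.
  have -> : widen_ord (leqnSn n) i = lift ord_max i.
    by apply: val_inj; exact: esym (lift_max i).
  by rewrite gb.
have cz0 : c ord_max != 0.
  apply: contraNneq ci1 => cz0; move: sumc; rewrite sumE cz0 mul0r add0r => e.
  have := b_free _ e; case: (unliftP ord_max i1) => [k ->|-> _]; last first.
    exact/eqP.
  by move=> -> //.
exists [ffun i => - c (lift ord_max i) / c ord_max]; split.
  split=> [i|]; first by rewrite ffunE; apply: K0_V => //; apply: K0_N.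
  move: sumc; rewrite sumE => /eqP; rewrite addr_eq0 => /eqP e.
  rewrite -[LHS](mulKf cz0) e mulrN mulr_sumr -sumrN.
  by apply: eq_bigr => i _; rewrite ffunE; field.
move=> c' [c'0 zc']; apply/ffunP => i; rewrite ffunE.
pose d i := - c (lift ord_max i) / c ord_max - c' i.
suff /(_ i)/eqP : forall i, d i = 0 by rewrite subr_eq0 => /eqP.
apply: b_free => [k|].
  by apply: K0_B => //; apply: K0_V => //; apply: K0_N.
under eq_bigr => k _ do rewrite mulrBl.
rewrite sumrB -zc'; apply/eqP; rewrite subr_eq0; apply/eqP.
move: sumc; rewrite sumE => /eqP; rewrite addr_eq0 => /eqP e.
rewrite -[RHS](mulKf cz0) e mulrN mulr_sumr -sumrN.
by apply: eq_bigr => k _; field.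
Qed.

(** If the minimal polynomial f of z has zero derivative, then p divides its
    degree, which is at most n < 2 p; hence K0(z) has dimension p over K0.
    Either K = K0(z), and then n independent elements live in dimension p < n,
    or some w lies outside and the 2 p > n elements z^i, w z^i are independent
    over K0.  Both are impossible. *)
Lemma ext_separable_of_free (p : nat) :
  p \in [pchar E] -> (n < p.*2)%N -> n != p -> ext_separable K0 K.
Proof.
move=> pE n2p np z Kz.
have [F0 [j jP]] := subfield_rmorphism K0_1 K0_B K0_V.
have jK m (c : 'I_m -> E) : (forall i, K0 (c i)) ->
    exists a : nat -> F0, forall i, c i = j (a (val i)).
  move=> c0; have /fin_all_exists[a ca] : forall i, exists a, c i = j a.
    by move=> i; apply/jP.
  exists (fun i => if insub i is Some i' then a i' else 0) => i.
  by rewrite valK.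
have KX i : K (z ^+ i).
  by elim: i => [|i IH]; rewrite ?expr0 ?exprS //; apply: K_M.
pose ev f := (map_poly j f).[z].
have evM f h : ev (f * h) = ev f * ev h by rewrite /ev rmorphM hornerM.
have evD f h : ev (f + h) = ev f + ev h by rewrite /ev rmorphD hornerD.
have evE m (f : {poly F0}) : (size f <= m)%N -> ev f = \sum_(i < m) j f`_i * z ^+ i.
  move=> sf; rewrite /ev (@horner_coef_wide _ m) ?size_map_poly //.
  by apply: eq_bigr => i _; rewrite coef_map.
have evP m (a : nat -> F0) :
    ev (\poly_(i < m) a i) = \sum_(i < m) j (a i) * z ^+ i.
  rewrite (evE m) ?size_poly //.
  by apply: eq_bigr => i _; rewrite coef_poly ltn_ord.
have [q [q0 sq evq]] : exists q : {poly F0}, [/\ q != 0, (size q <= n.+1)%N & ev q = 0].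
  have [c [c0 [i ci] sumc]] := K_dep (fun i => KX (val i)).
  have [a ca] := jK _ _ c0.
  exists (\poly_(i < n.+1) a i); split; rewrite ?size_poly //.
    apply: contraNneq ci => /(congr1 (coefp i)).
    by rewrite /= coef_poly ltn_ord coef0 ca => ->; rewrite rmorph0.
  by rewrite evP -[RHS]sumc; apply: eq_bigr => k _; rewrite ca.
have [f [fm f_sz evf fmin]] : exists f : {poly F0}, [/\ f \is monic, (size f <= n.+1)%N,
    ev f = 0 & forall g, g != 0 -> ev g = 0 -> (size f <= size g)%N].
  move: {2}(size q) (leqnn (size q)) => m.
  elim: m => [|m IH] in q q0 sq evq * => sqm.
    by move: q0; rewrite -size_poly_eq0 -leqn0 sqm.
  have [[g [g0 evg gq]]|nog] := classic (exists g : {poly F0}, [/\ g != 0, ev g = 0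
      & (size g < size q)%N]).
    apply: (IH g) => //; last by rewrite -ltnS; apply: leq_trans gq sqm.
    exact: leq_trans (ltnW gq) sq.
  have lq0 : lead_coef q != 0 by rewrite lead_coef_eq0.
  exists ((lead_coef q)^-1 *: q); split.
  - by rewrite monicE lead_coefZ mulVf.
  - by rewrite size_scale ?invr_eq0.
  - by rewrite -mul_polyC evM evq mulr0.
  - move=> g g0 evg; rewrite size_scale ?invr_eq0 // leqNgt.
    by apply/negP => gq; apply: nog; exists g.
have f0 := monic_neq0 fm.
(* Minimality makes f irreducible, so smaller nonzero polynomials are prime to f. *)
have fcop (g : {poly F0}) : g != 0 -> (size g < size f)%N -> coprimep f g.
  move=> g0 gf; have df := dvdp_gcdl f g; have dg := dvdp_gcdr f g.
  have fE := divpK df; have d0 : gcdp f g != 0 by rewrite gcdp_eq0 negb_and f0.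
  have q'0 : f %/ gcdp f g != 0 by apply: contraNneq f0 => e; rewrite -fE e mul0r.
  move/(congr1 ev): (fE); rewrite evM evf => /eqP; rewrite mulf_eq0.
  case/orP=> /eqP /fmin; last first.
    by move/(_ d0)/leq_trans/(_ (dvdp_leq g0 dg))/leq_ltn_trans/(_ gf); rewrite ltnn.
  move=> /(_ q'0); have := size_mul q'0 d0; rewrite fE coprimep_def.
  move: d0 q'0; rewrite -!size_poly_gt0 => d0 q'0 -> le_q.
  move: le_q; rewrite -subn1 leq_subLR addnC leq_add2r => le1.
  by rewrite eqn_leq d0 andbT.
(* Hence the polynomials in z of degree below that of f form a field. *)
have evinv (g : {poly F0}) : g != 0 -> (size g < size f)%N -> exists u, ev u * ev g = 1.
  move=> g0 gf; have /Bezout_eq1_coprimepP[[u v] /= e] := fcop g g0 gf.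
  exists v; rewrite -evM; move/(congr1 ev): e; rewrite evD evM evf mulr0 add0r.
  by move=> ->; rewrite /ev rmorph1 hornerC.
exists (map_poly j f).
  split; first by rewrite map_monic.
  - by move=> i; apply/jP; exists f`_i; rewrite coef_map.
  - by apply/rootP.
  - move=> g gK g0 /rootP gz.
    have [a ga] := jK _ (fun i : 'I_(size g) => g`_i) (fun i => gK i).
    have gE : g = map_poly j (\poly_(i < size g) a i).
      apply/polyP => i; rewrite coef_map coef_poly.
      case: ltnP => [lti|gei]; first exact: (ga (Ordinal lti)).
      by rewrite [RHS]rmorph0 nth_default.
    rewrite gE !size_map_poly; apply: fmin; last by rewrite /ev -gE.
    by apply: contraNneq g0 => e; rewrite gE e rmorph0.
rewrite separable_map; have [f'0|f'0] := eqVneq f^`() 0; last first.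
  by rewrite unlock; apply: fcop => //; apply: lt_size_deriv.
(* The inseparable case: the degree m.+1 of f must be p. *)
exfalso; have sf1 : (1 < size f)%N.
  rewrite ltnNge; apply/negP => /size1_polyC fC.
  have := evf; rewrite /ev fC map_polyC hornerC => /eqP; rewrite fmorph_eq0.
  by move=> e; move: f0; rewrite fC polyC_eq0 e.
have [m sfm] : exists m, size f = m.+2 by case: (size f) sf1 => [|[|m]] // _; exists m.
have mp : m.+1 = p.
  have : (p %| m.+1)%N.
    rewrite (dvdn_pcharf pE) -(rmorph_nat j) fmorph_eq0.
    move/(congr1 (coefp m)): f'0; rewrite /= coef_deriv coef0.
    by move: fm; rewrite monicE /lead_coef sfm /= => /eqP -> ->.
  case/dvdnP => [[|[|k]]]; rewrite ?mul1n // => e; move: f_sz; rewrite sfm.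
  by rewrite e => /leq_trans/(_ n2p); rewrite -mul2n; nia.
have pn : (p < n)%N by rewrite -mp in np *; rewrite ltn_neqAle eq_sym np -ltnS -sfm.
(* K = K0(z) would put the n free elements into dimension p. *)
have [span|nospan] := classic (forall w, K w -> exists2 g : {poly F0}, (size g <= p)%N
    & w = ev g).
  have [i||c [[i ci] sumc]] := @dependent_of_span F0 E j 'I_n 'I_p b (fun i => z ^+ i).
  - have [g sg ->] := span _ (Kb i); exists (fun i : 'I_p => g`_i); exact: evE.
  - by rewrite !card_ord.
  have jc0 : j (c i) = 0.
    apply: (b_free (c := fun i => j (c i)) _ sumc) => k.
    by apply/jP; exists (c k).
  by move/eqP: jc0; rewrite fmorph_eq0 (negPf ci).
have [w Kw wspan] : exists2 w, K w & forall g : {poly F0}, (size g <= p)%N -> w <> ev g.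
  apply: NNPP => now; apply: nospan => w Kw; apply: NNPP => nog; apply: now.
  by exists w => // g sg wg; apply: nog; exists g.
(* A relation between n.+1 of the 2 p elements z^i, w z^i reads f1 + f2 w = 0
   with f1, f2 in K0(z), and w would be a quotient of two elements of K0(z). *)
pose g (i : 'I_n.+1) := if (i < p)%N then z ^+ i else z ^+ (i - p) * w.
have Kg i : K (g i) by rewrite /g; case: ifP => // _; apply: K_M.
have [c [c0 [i1 ci1] sumc]] := K_dep Kg; have [a ca] := jK _ _ c0.
pose f1 := \poly_(i < p) a i.
pose f2 := \poly_(i < p) if (i + p < n.+1)%N then a (i + p)%N else 0.
have f12 : ev f1 + ev f2 * w = 0.
  rewrite -[RHS]sumc !evP mulr_suml.
  pose G i := if (i < p)%N then j (a i) * z ^+ i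
    else j (if (i < n.+1)%N then a i else 0) * z ^+ (i - p) * w.
  transitivity (\sum_(0 <= i < n.+1) G i); last first.
    rewrite big_mkord; apply: eq_bigr => i _; rewrite /G /g ca.
    by case: ifP => //; rewrite ltn_ord mulrA.
  transitivity (\sum_(0 <= i < p + p) G i); last first.
    rewrite [LHS](@big_cat_nat _ _ _ n.+1) ?addnn //=.
    rewrite [X in _ + X]big_nat [X in _ + X]big1 ?addr0 // => i /andP[ni _].
    rewrite /G ltnNge (leq_trans (ltnW pn) (ltnW ni)) /= ltnNge ni /=.
    by rewrite rmorph0 !mul0r.
  rewrite [RHS](@big_cat_nat _ _ _ p) ?leq_addr //=.
  have -> : \sum_(p <= i < p + p) G i = \sum_(i < p) G (i + p)%N.
    by rewrite -{1}[p]add0n big_addn addnK big_mkord.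
  rewrite big_mkord; congr (_ + _); apply: eq_bigr => i _.
    by rewrite /G ltn_ord.
  by rewrite /G (_ : (i + p < p)%N = false) ?addnK // ltnNge leq_addl.
have sf2 : (size f2 < size f)%N by rewrite sfm mp ltnS size_poly.
have sf1' : (size f1 < size f)%N by rewrite sfm mp ltnS size_poly.
have [f20|/evinv/(_ sf2)[u uf2]] := eqVneq f2 0.
  have f10 : f1 = 0.
    apply: contraTeq sf1' => f10; rewrite -leqNgt fmin //.
    by move: f12; rewrite f20 {2}/ev rmorph0 horner0 mul0r addr0.
  case/eqP: ci1; rewrite ca; have [ip|ip] := ltnP i1 p.
    by have := congr1 (coefp i1) f10; rewrite /= coef_poly ip coef0 => ->; rewrite rmorph0.
  have := congr1 (coefp (i1 - p)) f20; rewrite /= coef_poly coef0 subnK //.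
  rewrite ltn_ord ifT => [->|]; rewrite ?rmorph0 //.
  by rewrite ltn_subLR // addnn (leq_trans (ltn_ord i1)).
pose r := - (f1 * u) %% f; apply: (wspan r).
  by rewrite -mp -ltnS -sfm ltn_modp.
have -> : ev r = ev (- (f1 * u)).
  by rewrite [in RHS](divp_eq (- (f1 * u)) f) evD evM evf mulr0 add0r.
have -> : - (f1 * u) = (- f1) * u by rewrite mulNr.
have -> : ev (- f1 * u) = - ev f1 * ev u by rewrite evM /ev rmorphN hornerN.
by move/eqP: f12; rewrite addr_eq0 => /eqP ->; rewrite opprK mulrAC [_ * ev u]mulrC uf2 mul1r.
Qed.

End DegreeCriterion.

(** * Covariants of plane cubics *)

(** Polynomials with integer coefficients as explicit lists of terms: degrees
    are then checked by computation on the exponents, and evaluation commutes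
    with every ring morphism ([rmorph_teval]). *)
Variant term := Term of Z & seq nat.

Section Terms.

Variable R : comNzRingType.
Implicit Types (v : seq R) (e : seq nat) (l : seq term).

Fixpoint positiveR (p : positive) : R :=
  match p with
  | xH => 1
  | xO q => 2 * positiveR q
  | xI q => 1 + 2 * positiveR q
  end.

Definition integerR (z : Z) : R :=
  match z with Z0 => 0 | Zpos p => positiveR p | Zneg p => - positiveR p end.

Fixpoint monom v e : R :=
  if v is a :: v' then if e is i :: e' then a ^+ i * monom v' e' else 1 else 1.

Definition teval l v : R :=
  foldr (fun '(Term z e) r => integerR z * monom v e + r) 0 l.

End Terms.

Arguments teval : simpl never.

Lemma rmorph_integerR (R R' : comNzRingType) (f : {rmorphism R -> R'}) z :
  f (integerR R z) = integerR R' z.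
Proof.
have fp p : f (positiveR R p) = positiveR R' p.
  by elim: p => [p IH|p IH|] /=;
    rewrite ?(rmorphD, rmorphM, rmorph1, rmorph_nat) ?IH.
by case: z => [|p|p] /=; rewrite ?rmorph0 ?rmorphN ?fp.
Qed.

Lemma rmorph_monom (R R' : comNzRingType) (f : {rmorphism R -> R'}) v e :
  f (monom v e) = monom (map f v) e.
Proof.
elim: v e => [|a v IHv] [|i e] /=; rewrite ?rmorph1 //.
by rewrite rmorphM rmorphXn IHv.
Qed.

Lemma rmorph_teval (R R' : comNzRingType) (f : {rmorphism R -> R'}) l v :
  f (teval l v) = teval l (map f v).
Proof.
rewrite /teval; elim: l => [|[z e] l IHl] /=; first exact: rmorph0.
by rewrite rmorphD rmorphM rmorph_integerR rmorph_monom IHl.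
Qed.

(** In this and the next two lists the variables are x, w, y, c, s, a, b, g, and
    the cubic is F = c x^3 + s w^3 - y^2 (a x + b w + g y).  This one is the
    Hessian determinant of F divided by -24. *)
Definition hess_terms : seq term :=
  [:: Term 3 [:: 2; 1; 0; 1; 1; 1; 0; 0]; Term 3 [:: 1; 2; 0; 1; 1; 0; 1; 0];
      Term 9 [:: 1; 1; 1; 1; 1; 0; 0; 1]; Term 1 [:: 1; 0; 2; 1; 0; 0; 2; 0];
      Term 1 [:: 0; 1; 2; 0; 1; 2; 0; 0]].

(** Modulo F, a quarter of the gradient of hess_terms paired with itself through
    the adjugate of the Hessian matrix of F. *)
Definition theta_terms : seq term :=
  [:: Term (-729) [:: 6; 0; 0; 4; 2; 0; 0; 2];
      Term 108 [:: 6; 0; 0; 4; 1; 0; 3; 0];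
      Term 54 [:: 6; 0; 0; 3; 2; 3; 0; 0];
      Term (-486) [:: 5; 0; 1; 3; 2; 2; 0; 1];
      Term (-81) [:: 4; 2; 0; 3; 2; 1; 2; 0];
      Term (-486) [:: 4; 1; 1; 3; 2; 1; 1; 1];
      Term (-54) [:: 4; 0; 2; 3; 1; 1; 3; 0];
      Term (-135) [:: 4; 0; 2; 2; 2; 4; 0; 0];
      Term (-729) [:: 3; 3; 0; 3; 3; 0; 0; 2];
      Term 81 [:: 3; 3; 0; 3; 2; 0; 3; 0]; Term 81 [:: 3; 3; 0; 2; 3; 3; 0; 0];
      Term (-243) [:: 3; 2; 1; 3; 2; 0; 2; 1];
      Term (-27) [:: 3; 1; 2; 3; 1; 0; 4; 0];
      Term (-216) [:: 3; 1; 2; 2; 2; 3; 1; 0];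
      Term (-81) [:: 2; 4; 0; 2; 3; 2; 1; 0];
      Term (-243) [:: 2; 3; 1; 2; 3; 2; 0; 1];
      Term (-108) [:: 2; 2; 2; 2; 2; 2; 2; 0];
      Term 18 [:: 2; 0; 4; 1; 2; 5; 0; 0];
      Term (-486) [:: 1; 4; 1; 2; 3; 1; 1; 1];
      Term (-216) [:: 1; 3; 2; 2; 2; 1; 3; 0];
      Term (-27) [:: 1; 3; 2; 1; 3; 4; 0; 0];
      Term 18 [:: 1; 1; 4; 2; 1; 1; 4; 0]; Term 18 [:: 1; 1; 4; 1; 2; 4; 1; 0];
      Term (-729) [:: 0; 6; 0; 2; 4; 0; 0; 2];
      Term 54 [:: 0; 6; 0; 2; 3; 0; 3; 0];
      Term 108 [:: 0; 6; 0; 1; 4; 3; 0; 0];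
      Term (-486) [:: 0; 5; 1; 2; 3; 0; 2; 1];
      Term (-135) [:: 0; 4; 2; 2; 2; 0; 4; 0];
      Term (-54) [:: 0; 4; 2; 1; 3; 3; 1; 0];
      Term 18 [:: 0; 2; 4; 2; 1; 0; 5; 0]; Term (-1) [:: 0; 0; 6; 2; 0; 0; 6; 0];
      Term 2 [:: 0; 0; 6; 1; 1; 3; 3; 0]; Term (-1) [:: 0; 0; 6; 0; 2; 6; 0; 0]].

(** Modulo F, minus a third of the Jacobian determinant of F, hess_terms and
    theta_terms. *)
Definition jac_terms : seq term :=
  [:: Term 39366 [:: 9; 0; 0; 6; 3; 0; 0; 3];
      Term (-8748) [:: 9; 0; 0; 6; 2; 0; 3; 1];
      Term (-4374) [:: 9; 0; 0; 5; 3; 3; 0; 1];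
      Term 39366 [:: 8; 0; 1; 5; 3; 2; 0; 2];
      Term (-2916) [:: 8; 0; 1; 5; 2; 2; 3; 0];
      Term (-2916) [:: 8; 0; 1; 4; 3; 5; 0; 0];
      Term 6561 [:: 7; 2; 0; 5; 3; 1; 2; 1];
      Term 39366 [:: 7; 1; 1; 5; 3; 1; 1; 2];
      Term (-4374) [:: 7; 1; 1; 5; 2; 1; 4; 0];
      Term (-2916) [:: 7; 1; 1; 4; 3; 4; 1; 0];
      Term 4374 [:: 7; 0; 2; 5; 2; 1; 3; 1];
      Term 17496 [:: 7; 0; 2; 4; 3; 4; 0; 1];
      Term 59049 [:: 6; 3; 0; 5; 4; 0; 0; 3];
      Term (-10935) [:: 6; 3; 0; 5; 3; 0; 3; 1];
      Term (-8748) [:: 6; 3; 0; 4; 4; 3; 0; 1];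
      Term 19683 [:: 6; 2; 1; 5; 3; 0; 2; 2];
      Term (-2916) [:: 6; 2; 1; 5; 2; 0; 5; 0];
      Term 1458 [:: 6; 2; 1; 4; 3; 3; 2; 0];
      Term 2187 [:: 6; 1; 2; 5; 2; 0; 4; 1];
      Term 30618 [:: 6; 1; 2; 4; 3; 3; 1; 1];
      Term 405 [:: 6; 0; 3; 5; 1; 0; 6; 0];
      Term 1620 [:: 6; 0; 3; 4; 2; 3; 3; 0];
      Term 4536 [:: 6; 0; 3; 3; 3; 6; 0; 0];
      Term (-13122) [:: 5; 4; 0; 4; 4; 2; 1; 1];
      Term 39366 [:: 5; 3; 1; 4; 4; 2; 0; 2];
      Term (-4374) [:: 5; 3; 1; 3; 4; 5; 0; 0];
      Term 21870 [:: 5; 2; 2; 4; 3; 2; 2; 1];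
      Term 3645 [:: 5; 1; 3; 4; 2; 2; 4; 0];
      Term 10206 [:: 5; 1; 3; 3; 3; 5; 1; 0];
      Term 13122 [:: 4; 5; 0; 4; 4; 1; 2; 1];
      Term 7290 [:: 4; 4; 1; 4; 3; 1; 4; 0];
      Term (-7290) [:: 4; 4; 1; 3; 4; 4; 1; 0];
      Term 10935 [:: 4; 3; 2; 3; 4; 4; 0; 1];
      Term (-486) [:: 4; 2; 3; 4; 2; 1; 5; 0];
      Term 8505 [:: 4; 2; 3; 3; 3; 4; 2; 0];
      Term (-81) [:: 4; 0; 5; 4; 1; 1; 6; 0];
      Term (-648) [:: 4; 0; 5; 2; 3; 7; 0; 0];
      Term (-59049) [:: 3; 6; 0; 4; 5; 0; 0; 3];
      Term 8748 [:: 3; 6; 0; 4; 4; 0; 3; 1];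
      Term 10935 [:: 3; 6; 0; 3; 5; 3; 0; 1];
      Term (-39366) [:: 3; 5; 1; 4; 4; 0; 2; 2];
      Term 4374 [:: 3; 5; 1; 4; 3; 0; 5; 0];
      Term (-10935) [:: 3; 4; 2; 4; 3; 0; 4; 1];
      Term (-1701) [:: 3; 3; 3; 4; 2; 0; 6; 0];
      Term 1701 [:: 3; 3; 3; 2; 4; 6; 0; 0];
      Term 81 [:: 3; 1; 5; 4; 1; 0; 7; 0];
      Term (-405) [:: 3; 1; 5; 3; 2; 3; 4; 0];
      Term (-1134) [:: 3; 1; 5; 2; 3; 6; 1; 0];
      Term (-6561) [:: 2; 7; 0; 3; 5; 2; 1; 1];
      Term (-19683) [:: 2; 6; 1; 3; 5; 2; 0; 2];
      Term (-1458) [:: 2; 6; 1; 3; 4; 2; 3; 0];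
      Term 2916 [:: 2; 6; 1; 2; 5; 5; 0; 0];
      Term (-21870) [:: 2; 5; 2; 3; 4; 2; 2; 1];
      Term (-8505) [:: 2; 4; 3; 3; 3; 2; 4; 0];
      Term 486 [:: 2; 4; 3; 2; 4; 5; 1; 0];
      Term 567 [:: 2; 2; 5; 3; 2; 2; 5; 0];
      Term (-567) [:: 2; 2; 5; 2; 3; 5; 2; 0];
      Term (-54) [:: 2; 0; 7; 2; 2; 5; 3; 0];
      Term 54 [:: 2; 0; 7; 1; 3; 8; 0; 0];
      Term (-39366) [:: 1; 7; 1; 3; 5; 1; 1; 2];
      Term 2916 [:: 1; 7; 1; 3; 4; 1; 4; 0];
      Term 4374 [:: 1; 7; 1; 2; 5; 4; 1; 0];
      Term (-30618) [:: 1; 6; 2; 3; 4; 1; 3; 1];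
      Term (-2187) [:: 1; 6; 2; 2; 5; 4; 0; 1];
      Term (-10206) [:: 1; 5; 3; 3; 3; 1; 5; 0];
      Term (-3645) [:: 1; 5; 3; 2; 4; 4; 2; 0];
      Term 1134 [:: 1; 3; 5; 3; 2; 1; 6; 0];
      Term 405 [:: 1; 3; 5; 2; 3; 4; 3; 0];
      Term (-81) [:: 1; 3; 5; 1; 4; 7; 0; 0];
      Term (-54) [:: 1; 1; 7; 3; 1; 1; 7; 0];
      Term 54 [:: 1; 1; 7; 1; 3; 7; 1; 0];
      Term (-39366) [:: 0; 9; 0; 3; 6; 0; 0; 3];
      Term 4374 [:: 0; 9; 0; 3; 5; 0; 3; 1];
      Term 8748 [:: 0; 9; 0; 2; 6; 3; 0; 1];
      Term (-39366) [:: 0; 8; 1; 3; 5; 0; 2; 2];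
      Term 2916 [:: 0; 8; 1; 3; 4; 0; 5; 0];
      Term 2916 [:: 0; 8; 1; 2; 5; 3; 2; 0];
      Term (-17496) [:: 0; 7; 2; 3; 4; 0; 4; 1];
      Term (-4374) [:: 0; 7; 2; 2; 5; 3; 1; 1];
      Term (-4536) [:: 0; 6; 3; 3; 3; 0; 6; 0];
      Term (-1620) [:: 0; 6; 3; 2; 4; 3; 3; 0];
      Term (-405) [:: 0; 6; 3; 1; 5; 6; 0; 0];
      Term 648 [:: 0; 4; 5; 3; 2; 0; 7; 0];
      Term 81 [:: 0; 4; 5; 1; 4; 6; 1; 0];
      Term (-54) [:: 0; 2; 7; 3; 1; 0; 8; 0];
      Term 54 [:: 0; 2; 7; 2; 2; 3; 5; 0]; Term 2 [:: 0; 0; 9; 3; 0; 0; 9; 0];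
      Term (-6) [:: 0; 0; 9; 2; 1; 3; 6; 0]; Term 6 [:: 0; 0; 9; 1; 2; 6; 3; 0];
      Term (-2) [:: 0; 0; 9; 0; 3; 9; 0; 0]].

Section Covariants.

Variable R : comNzRingType.
Implicit Types x w y c s a b g : R.

Definition cubic x w y c s a b g : R :=
  c * x ^+ 3 + s * w ^+ 3 - y ^+ 2 * (a * x + b * w + g * y).

(** The classical syzygy, with the invariants of degrees 4 and 6 of the cubic as
    coefficients: it says that theta / hess^2 and jac / hess^3 lie on the
    Jacobian of the cubic.  The identity holds modulo F, that is after the
    substitution of g y^3. *)
Lemma covariant_syzygy x w y c s a b g (v := [:: x; w; y; c; s; a; b; g]) :
  cubic x w y c s a b g = 0 ->
  teval jac_terms v ^+ 2 = - 4 * teval theta_terms v ^+ 3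
    + 972 * c * s * a * b * teval theta_terms v * teval hess_terms v ^+ 4
    + (- 19683 * c ^+ 2 * s ^+ 2 * g ^+ 2
       + 2916 * (c ^+ 2 * s * b ^+ 3 + c * s ^+ 2 * a ^+ 3))
      * teval hess_terms v ^+ 6.
Proof.
rewrite /cubic => F0.
have e : g * y ^+ 3 = c * x ^+ 3 + s * w ^+ 3 - y ^+ 2 * (a * x + b * w).
  by rewrite (subr0_eq F0); ring.
rewrite {}/v /teval /=.
ring: e.
Qed.

Lemma covariant_syzygy5 x w y c s a b g (v := [:: x; w; y; c; s; a; b; g]) :
  5 = 0 :> R -> cubic x w y c s a b g = 0 ->
  teval jac_terms v ^+ 2 = teval theta_terms v ^+ 3
    + 2 * c * s * a * b * teval theta_terms v * teval hess_terms v ^+ 4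
    + (2 * c ^+ 2 * s ^+ 2 * g ^+ 2 + c ^+ 2 * s * b ^+ 3 + c * s ^+ 2 * a ^+ 3)
      * teval hess_terms v ^+ 6.
Proof.
move=> five /covariant_syzygy; rewrite -/v; move: (teval _ v) (teval _ v).
move: (teval _ v) => h th j ->.
transitivity (th ^+ 3 + 2 * c * s * a * b * th * h ^+ 4
  + (2 * c ^+ 2 * s ^+ 2 * g ^+ 2 + c ^+ 2 * s * b ^+ 3 + c * s ^+ 2 * a ^+ 3)
    * h ^+ 6 + 5 * (- th ^+ 3 + 194 * c * s * a * b * th * h ^+ 4
  + (- 3937 * c ^+ 2 * s ^+ 2 * g ^+ 2
     + 583 * (c ^+ 2 * s * b ^+ 3 + c * s ^+ 2 * a ^+ 3)) * h ^+ 6)).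
  by ring.
by rewrite five mul0r addr0.
Qed.

(** The member s = 1 of the pencil has nine flexes with distinct w over an
    extension of F_5.  Their values of w are the roots of the polynomial of
    degree 9 behind w9, obtained by eliminating x between the cubic and its
    Hessian; x is recovered from w by flex_x.  The lemmas below verify this, and
    that theta and jac are invertible at the flexes. *)
Section FlexPoints.

Hypothesis five : 5 = 0 :> R.
Variable w : R.
Hypothesis w9 : w ^+ 9 = - (1 + w ^+ 2 - w ^+ 3 + w ^+ 4 - 2 * w ^+ 5 + w ^+ 6
  + 2 * w ^+ 7 + 2 * w ^+ 8).

Definition flex_x : R :=
  1 + 2 * w + 2 * w ^+ 2 - 2 * w ^+ 4 + w ^+ 5 + w ^+ 8.

Local Notation v := [:: flex_x; w; 1; 1; 1; -1; -2; 1].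

Let five_mul a : 5 * a = 0. Proof. by rewrite five mul0r. Qed.

(* Here and below, the multiple of 5 is the quotient by 5 of the difference of
   the two sides after reduction over the integers. *)
Lemma flex_cubic : cubic flex_x w 1 1 1 (-1) (-2) 1 = 0.
Proof.
rewrite -(five_mul (37 * w ^+ 8 - 401 * w ^+ 7 + 362 * w ^+ 6 - 253 * w ^+ 5
  + 218 * w ^+ 4 - 149 * w ^+ 3 + 121 * w ^+ 2 - 94 * w - 3)).
by rewrite /cubic /flex_x; ring: w9.
Qed.

Lemma flex_hess : teval hess_terms v = 0.
Proof.
rewrite -(five_mul (- 7 * w ^+ 8 - 3 * w ^+ 7 + 72 * w ^+ 6 - 64 * w ^+ 5
  + 35 * w ^+ 4 - 39 * w ^+ 3 + 28 * w ^+ 2 - 18 * w + 17)).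
by rewrite /teval /= /flex_x; ring: w9.
Qed.

Lemma flex_theta : exists t, t * teval theta_terms v = 1.
Proof.
have x3 : flex_x ^+ 3 = 1 - w ^+ 3 - flex_x - 2 * w.
  by rewrite -[LHS]subr0 -flex_cubic /cubic; ring.
have x2 : flex_x ^+ 2
    = - w ^+ 8 + w ^+ 7 - w ^+ 6 + 2 * w ^+ 2 + 2 * w - 2.
  rewrite -[RHS]addr0 -(five_mul (7 * w ^+ 8 + 14 * w ^+ 7 + 12 * w ^+ 6
    - 18 * w ^+ 5 + 10 * w ^+ 4 - 8 * w ^+ 3 + 8 * w ^+ 2 - 3 * w + 8)).
  by rewrite /flex_x; ring: w9.
(* The inverse of theta modulo the polynomial behind w9. *)
exists (2 * w ^+ 7 + 2 * w ^+ 6 - 2 * w ^+ 5 - 2 * w ^+ 4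
  + w ^+ 2 + w).
have -> : teval theta_terms v =
    (2 * w ^+ 4 - 2 * w ^+ 3 - w ^+ 2 - w + 1) * flex_x ^+ 2
  + (w ^+ 5 - 2 * w ^+ 3 - w + 1) * flex_x
  + (2 * w ^+ 6 - 2 * w ^+ 5 - w ^+ 4 - w ^+ 3 + 2 * w ^+ 2 + 2 * w).
  rewrite -[RHS]addr0 -(five_mul (
      (32 * w ^+ 4 + 49 * w ^+ 3 - 151 * w ^+ 2 + 389 * w - 317) * flex_x ^+ 2
    + (- 65 * w ^+ 5 - 734 * w ^+ 3 + 648 * w ^+ 2 - 1177 * w + 448) * flex_x
    + (- 292 * w ^+ 6 - 194 * w ^+ 5 - 1015 * w ^+ 4 + 659 * w ^+ 3
       - 1282 * w ^+ 2 + 950 * w - 242))).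
  by rewrite /teval /=; ring: x3.
rewrite x2 /flex_x.
transitivity (1 + 5 * (232 * w ^+ 8 + 126 * w ^+ 7 + 244 * w ^+ 6 - 326 * w ^+ 5
  + 196 * w ^+ 4 - 171 * w ^+ 3 + 133 * w ^+ 2 - 45 * w + 118)).
  by ring: w9.
by rewrite five_mul addr0.
Qed.

(** At a flex the syzygy reduces to jac^2 = theta^3. *)
Lemma flex_jac : exists t, t * teval jac_terms v = 1.
Proof.
have [t tE] := flex_theta; have := covariant_syzygy flex_cubic.
rewrite flex_hess 2!(exprS 0) !mul0r !mulr0 !addr0 => J2.
exists (t ^+ 3 * teval jac_terms v).
rewrite -mulrA -expr2 J2.
transitivity ((t * teval theta_terms v) ^+ 3
  - 5 * (t * teval theta_terms v) ^+ 3); first by ring.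
by rewrite five_mul tE expr1n subr0.
Qed.

End FlexPoints.

End Covariants.

Lemma rmorph_cubic (R R' : comNzRingType) (f : {rmorphism R -> R'}) x w y c s a b g :
  f (cubic x w y c s a b g)
  = cubic (f x) (f w) (f y) (f c) (f s) (f a) (f b) (f g).
Proof. by rewrite /cubic rmorphB !(rmorphXn, rmorphD, rmorphM). Qed.

(** * Evaluation at points and the algebra of flexes *)

(** The polynomial ring of the affine plane: the inner variable is w, the outer
    one x.  It also serves for k[s, X], with s inside. *)
Notation poly2 := {poly {poly 'F_5}}.

Section Evaluation.

Variables (A R : comNzRingType) (f : {rmorphism A -> R}).

Definition ev1 (a : R) : {poly A} -> R := horner_morph (fun c => mulrC a (f c)).
HB.instance Definition _ a := GRing.RMorphism.on (ev1 a).

Lemma ev1C a c : ev1 a c%:P = f c.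
Proof. exact: horner_morphC. Qed.

Lemma ev1X a : ev1 a 'X = a.
Proof. exact: horner_morphX. Qed.

Lemma ev1E a (p : {poly A}) n : (size p <= n)%N -> ev1 a p = \sum_(i < n) f p`_i * a ^+ i.
Proof.
move=> sp; rewrite /ev1 /horner_morph (@horner_coef_wide _ n).
  by apply: eq_bigr => i _; rewrite coef_map.
exact: leq_trans (size_poly _ _) sp.
Qed.

End Evaluation.

Definition ev2 (k R : comNzRingType) (f : {rmorphism k -> R}) (a b : R) :
  {poly {poly k}} -> R := ev1 (ev1 f a) b.
HB.instance Definition _ k R f a b :=
  GRing.RMorphism.on (@ev2 k R f a b).

Lemma ev2CC (k R : comNzRingType) (f : {rmorphism k -> R}) a b c :
  ev2 f a b c%:P%:P = f c.
Proof. by rewrite /ev2 ev1C /= ?ev1C. Qed.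

Lemma ev2C (k R : comNzRingType) (f : {rmorphism k -> R}) a b p :
  ev2 f a b p%:P = ev1 f a p.
Proof. by rewrite /ev2 ev1C /= ?ev1C. Qed.

Lemma ev2Y (k R : comNzRingType) (f : {rmorphism k -> R}) a b :
  ev2 f a b 'X = b.
Proof. by rewrite /ev2 ev1X. Qed.

Lemma ev2X (k R : comNzRingType) (f : {rmorphism k -> R}) a b :
  ev2 f a b 'X%:P = a.
Proof. by rewrite /ev2 ev1C /= ev1X. Qed.

Lemma five_poly : 5 = 0 :> poly2.
Proof.
have -> : 5 = (5 : 'F_5)%:P%:P :> poly2 by rewrite !rmorph_nat.
by rewrite (_ : 5 = 0 :> 'F_5) ?rmorph0 //; apply/eqP.
Qed.

Definition flex_poly : {poly 'F_5} :=
  'X^9 + (1 + 'X^2 - 'X^3 + 'X^4 - 2 * 'X^5 + 'X^6 + 2 * 'X^7 + 2 * 'X^8).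

Lemma flex_polyE : flex_poly = 'X^9 + \poly_(i < 9)
  [:: 1; 0; 1; -1; 1; -2; 1; 2; 2]`_i.
Proof.
congr (_ + _); rewrite poly_def !big_ord_recl big_ord0 /=.
rewrite -!mul_polyC !rmorphN !rmorph_nat !rmorph1 rmorph0.
rewrite /bump /=; ring.
Qed.

Lemma size_flex_poly : size flex_poly = 10%N.
Proof.
rewrite flex_polyE size_polyDl ?size_polyXn //.
exact: leq_trans (size_poly _ _) _.
Qed.

Lemma monic_flex_poly : flex_poly \is monic.
Proof.
rewrite monicE /lead_coef size_flex_poly flex_polyE coefD coefXn coef_poly.
by rewrite /= addr0.
Qed.

(** F_5[w] modulo flex_poly: the coordinate ring of the flexes of the member
    s = 1. *)
Lemma flex_algebra : exists (A : comNzRingType) (f : {rmorphism 'F_5 -> A}) (w : A),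
  [/\ 5 = 0 :> A,
   w ^+ 9 = - (1 + w ^+ 2 - w ^+ 3 + w ^+ 4 - 2 * w ^+ 5 + w ^+ 6
     + 2 * w ^+ 7 + 2 * w ^+ 8)
   & forall c : nat -> 'F_5, \sum_(i < 9) f (c i) * w ^+ i = 0 ->
     forall i, (i < 9)%N -> c i = 0].
Proof.
pose A : comNzRingType := {poly %/ flex_poly}.
pose pi : {rmorphism {poly 'F_5} -> A} := in_qpoly flex_poly.
pose f : {rmorphism 'F_5 -> A} := pi \o polyC.
have piE c i : f c * pi 'X ^+ i = pi (c *: 'X^i).
  by rewrite -mul_polyC rmorphM rmorphXn.
exists A, f, (pi 'X); split.
- rewrite -(rmorph_nat f) (_ : 5 = 0 :> 'F_5) ?rmorph0 //; exact/eqP.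
- apply/eqP; rewrite -addr_eq0; apply/eqP.
  transitivity (pi flex_poly).
    by rewrite /flex_poly !(rmorphXn, rmorph_nat, rmorph1, rmorphD, rmorphN, rmorphM).
  apply: val_inj; rewrite /= /mk_monic size_flex_poly monic_flex_poly /=.
  exact: (Pdiv.RingMonic.rmodpp monic_flex_poly).
- move=> c; under eq_bigr => i _ do rewrite piE.
  rewrite -rmorph_sum /= => e i lti.
  have sz : (size (\sum_(i < 9) c i *: 'X^i)%R <= 9)%N.
    by rewrite -poly_def size_poly.
  have := congr1 (fun p : A => (p : {poly 'F_5})`_i) e.
  rewrite /= /mk_monic size_flex_poly monic_flex_poly /=.
  rewrite Pdiv.CommonRing.rmodp_small; last by rewrite size_flex_poly ltnS.
  by rewrite -poly_def coef_poly lti coef0.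
Qed.

(** * The member of the pencil at parameter 1 *)

(** The sum over k < m of c k * b k * h^(m - 1 - k): a combination of quotients
    b k / h^k cleared of denominators ([hsumE]).  Modulo h only the term of the
    highest pole remains. *)
Fixpoint hsum (R : comNzRingType) (h : R) (c b : nat -> R) (m : nat) : R :=
  if m is m'.+1 then h * hsum h c b m' + c m' * b m' else 0.

Lemma rmorph_hsum (R R' : comNzRingType) (f : {rmorphism R -> R'}) h c b m :
  f (hsum h c b m) = hsum (f h) (f \o c) (f \o b) m.
Proof. by elim: m => [|m IH] /=; rewrite ?rmorph0 // rmorphD !rmorphM IH. Qed.

Lemma eq_hsum (R : comNzRingType) (h : R) c c' b b' m :
  (forall k, (k < m)%N -> c k * b k = c' k * b' k) ->
  hsum h c b m = hsum h c' b' m.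
Proof.
elim: m => //= m IH ec; rewrite ec // IH // => k km.
by apply: ec; apply: ltnW.
Qed.

Lemma hsumZ (R : comNzRingType) (h a : R) c b m :
  hsum h (fun k => a * c k) b m = a * hsum h c b m.
Proof. by elim: m => [|m IH] /=; rewrite ?mulr0 // IH; ring. Qed.

Lemma hsumE (E : fieldType) (h : E) c b m : h != 0 ->
  h * hsum h c b m = h ^+ m * \sum_(k < m) c k * (b k / h ^+ k).
Proof.
move=> h0; elim: m => [|m IH]; first by rewrite big_ord0 !mulr0.
rewrite big_ord_recr /= mulrDr IH mulrDr exprS; congr (_ + _).
  by rewrite mulrA.
by field; rewrite expf_neq0.
Qed.

(** Numerator of the monomial in X = t / h^2 and Y = j / h^3 that has a pole of
    order k along h = 0.  No monomial has a simple pole; the value 1 at k = 1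
    keeps k equal to the exponent of h in the denominator. *)
Definition pole_num (R : comNzRingType) (t j : R) (k : nat) : R :=
  if ~~ odd k then t ^+ k./2 else if k == 1%N then 1 else j * t ^+ (k - 3)./2.

Lemma rmorph_pole_num (R R' : comNzRingType) (f : {rmorphism R -> R'}) t j k :
  f (pole_num t j k) = pole_num (f t) (f j) k.
Proof.
rewrite /pole_num; case: ifP => _; first by rewrite rmorphXn.
by case: ifP => _; rewrite ?rmorph1 // rmorphM rmorphXn.
Qed.

Section SpecialFibre.

Local Notation x := ('X : poly2).
Local Notation w := ('X%:P : poly2).

(** The member of the pencil at s = 1, on which relations are specialised. *)
Definition fibre : poly2 := cubic x w 1 1 1 (-1) (-2) 1.

Definition fibre_dvd (g : poly2) : Prop := exists q, g = fibre * q.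

Lemma fibreE : fibre = 'X^3 + ('X + ('X^3 + 2 * 'X - 1)%:P).
Proof.
rewrite /fibre /cubic !(rmorphXn, rmorph_nat, rmorph1, rmorphD, rmorphN, rmorphM) /=.
ring.
Qed.

Lemma size_fibre : size fibre = 4%N.
Proof.
rewrite fibreE size_polyDl ?size_polyXn // size_XaddC //.
Qed.

Lemma monic_fibre : fibre \is monic.
Proof.
rewrite monicE /lead_coef size_fibre fibreE !coefD coefXn coefX coefC /=.
by rewrite !addr0.
Qed.

(** The remainder of r * g modulo the monic polynomial fibre is r times that of
    g, and the inner polynomial ring is a domain. *)
Lemma fibre_dvdC (r : {poly 'F_5}) (g : poly2) :
  r != 0 -> fibre_dvd (r%:P * g) -> fibre_dvd g.
Proof.
move=> r0 [q rg]; have gE := Pdiv.RingMonic.rdivp_eq monic_fibre g.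
have sm : (size (Pdiv.CommonRing.rmodp g fibre) < size fibre)%N.
  by apply: Pdiv.CommonRing.ltn_rmodpN0; apply: monic_neq0 monic_fibre.
move: gE sm; set q' := Pdiv.CommonRing.rdivp _ _.
set m := Pdiv.CommonRing.rmodp _ _ => gE sm; exists q'.
suff m0 : m = 0 by rewrite gE m0 addr0 mulrC.
have rm : r%:P * m = fibre * (q - r%:P * q').
  by rewrite mulrBr -rg {1}gE; ring.
have /eqP : r%:P * m = 0.
  have [z|q0] := eqVneq (q - r%:P * q') 0; first by rewrite rm z mulr0.
  have := size_monicM monic_fibre q0; rewrite -rm mul_polyC size_scale //.
  rewrite size_fibre => sz; move: sm; rewrite sz size_fibre.
  by move: q0; rewrite -size_poly_gt0; case: (size _).
by rewrite mulf_eq0 polyC_eq0 (negPf r0) => /eqP.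
Qed.

(** A nonzero resultant r with respect to x prevents h from being a zero divisor
    modulo fibre. *)
Lemma fibre_dvd_coprime (u v h g : poly2) (r : {poly 'F_5}) :
  r != 0 -> u * fibre + v * h = r%:P -> fibre_dvd (h * g) -> fibre_dvd g.
Proof.
move=> r0 bez [q hg]; apply: (fibre_dvdC r0); exists (u * g + v * q).
rewrite -bez; transitivity (u * g * fibre + v * (h * g)); first ring.
by rewrite hg; ring.
Qed.

Lemma neq0_horner (r : {poly 'F_5}) a : r.[a] != 0 -> r != 0.
Proof. by apply: contraNneq => ->; rewrite horner0. Qed.

Lemma fibre_dvd_denom g : fibre_dvd ((w ^+ 3 - 2 * x - 1) * g) -> fibre_dvd g.
Proof.
(* The denominator vanishes at x = a, since 3 is an inverse of 2 modulo 5, and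
   r is the value of fibre there. *)
pose a : {poly 'F_5} := 2 - 2 * 'X ^+ 3.
pose r := a ^+ 3 + 'X ^+ 3 + a + 2 * 'X - 1.
have aE : a%:P = 2 - 2 * w ^+ 3.
  by rewrite !(rmorphXn, rmorph_nat, rmorphD, rmorphN, rmorphM) /=.
have rE : r%:P = a%:P ^+ 3 + w ^+ 3 + a%:P + 2 * w - 1.
  by rewrite /r !(rmorphXn, rmorph_nat, rmorph1, rmorphD, rmorphN, rmorphM) /=.
apply: (@fibre_dvd_coprime 1 (- 2 * (x ^+ 2 + a%:P * x + a%:P ^+ 2 + 1)) _ _ r).
  by apply: (@neq0_horner _ 0); rewrite /r /a !hornerE.
transitivity (r%:P + 5 * (x * (x ^+ 2 + a%:P * x + a%:P ^+ 2 + 1))); last first.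
  by rewrite five_poly mul0r addr0.
rewrite rE aE /fibre /cubic; ring.
Qed.

Local Notation v := [:: x; w; 1; 1; 1; -1; -2; 1].

(** Two steps of the Euclidean algorithm: h2^2 times the cubic leaves a z + b
    modulo the quadratic polynomial, and a^2 times the latter leaves the
    right-hand side modulo a z + b. *)
Lemma bezout_quadratic_cubic (R : comNzRingType) (h2 h1 h0 q z : R) :
  let a := h2 * (h2 - h0) + h1 ^+ 2 in let b := h2 ^+ 2 * q + h1 * h0 in
  let e := h2 * a * z + h1 * a - h2 * b in
  - e * h2 ^+ 2 * (z ^+ 3 + z + q)
    + (a ^+ 2 + e * (h2 * z - h1)) * (h2 * z ^+ 2 + h1 * z + h0)
  = h2 * b ^+ 2 - h1 * a * b + h0 * a ^+ 2.
Proof. by move=> a b e; rewrite /e /a /b; ring. Qed.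

Lemma fibre_dvd_hess g : fibre_dvd (teval hess_terms v * g) -> fibre_dvd g.
Proof.
(* On the member s = 1 the Hessian is quadratic in x. *)
pose t : {poly 'F_5} := 'X; pose q := t ^+ 3 + 2 * t - 1.
pose h2 := - 3 * t; pose h1 := - 6 * t ^+ 2 + 9 * t + 4; pose h0 := t.
pose a := h2 * (h2 - h0) + h1 ^+ 2; pose b := h2 ^+ 2 * q + h1 * h0.
pose r := h2 * b ^+ 2 - h1 * a * b + h0 * a ^+ 2.
have hessE : teval hess_terms v = h2%:P * x ^+ 2 + h1%:P * x + h0%:P.
  have -> : h2%:P = - 3 * w.
    by rewrite /h2 !(rmorph_nat, rmorphN, rmorphM).
  have -> : h1%:P = - 6 * w ^+ 2 + 9 * w + 4.
    by rewrite /h1 !(rmorphXn, rmorph_nat, rmorphD, rmorphN, rmorphM).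
  by rewrite /teval /=; ring.
have fE : fibre = x ^+ 3 + x + q%:P by rewrite fibreE addrA.
have := bezout_quadratic_cubic h2%:P h1%:P h0%:P q%:P x.
rewrite /= -hessE -fE.
rewrite -!(rmorphXn, rmorphM, rmorphB, rmorphD) -/a -/b -/r /=.
apply: fibre_dvd_coprime; apply: (@neq0_horner _ 1).
have t1 : t.[1] = 1 by rewrite hornerX.
have h21 : h2.[1] = 2 by rewrite /h2 !hornerE; apply/eqP.
have h11 : h1.[1] = 2 by rewrite /h1 !hornerE; apply/eqP.
have q1 : q.[1] = 2 by rewrite /q !hornerE; apply/eqP.
have rE (p2 p1 p0 p : {poly 'F_5}) : let a := p2 * (p2 - p0) + p1 ^+ 2 in
    let b := p2 ^+ 2 * p + p1 * p0 in
    (p2 * b ^+ 2 - p1 * a * b + p0 * a ^+ 2).[1] =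
    let a := p2.[1] * (p2.[1] - p0.[1]) + p1.[1] ^+ 2 in
    let b := p2.[1] ^+ 2 * p.[1] + p1.[1] * p0.[1] in
    p2.[1] * b ^+ 2 - p1.[1] * a * b + p0.[1] * a ^+ 2.
  by rewrite /= !(hornerD, hornerN, hornerM, horner_exp).
by rewrite rE h21 h11 q1 t1.
Qed.

(** Evaluate at the flexes: fibre and the Hessian vanish there, so that only the
    coefficient of the highest pole survives, multiplied by a unit.  It is a
    polynomial in w of degree at most 8, determined by its values at the nine
    flexes, so it is zero.  Remove it, divide by the Hessian and repeat. *)
Lemma fibre_free (r : nat -> nat -> 'F_5) m :
  fibre_dvd (hsum (teval hess_terms v)
    (fun k => \sum_(i < 9) (r k i)%:P%:P * w ^+ i)
    (pole_num (teval theta_terms v) (teval jac_terms v)) m) ->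
  forall k i, (k < m)%N -> (i < 9)%N -> r k i = 0.
Proof.
have [A [f [t [five t9 t_free]]]] := flex_algebra.
pose chi : {rmorphism poly2 -> A} := ev2 f t (flex_x t).
pose vt := [:: flex_x t; t; 1; 1; 1; -1; -2; 1].
have chi_x : chi x = flex_x t by exact: ev2Y.
have chi_w : chi w = t by exact: ev2X.
have chi_1 : chi 1 = 1 := rmorph1 chi.
have chi_N1 : chi (-1) = -1 by rewrite (rmorphN chi) chi_1.
have chi_N2 : chi (-2) = -2 by rewrite (rmorphN chi) (rmorph_nat chi).
have chiv : map chi v = vt by rewrite /= chi_x chi_w chi_1 chi_N1 chi_N2.
have chi_fibre : chi fibre = 0.
  by rewrite /fibre rmorph_cubic chi_x chi_w chi_1 chi_N1 chi_N2 (flex_cubic five t9).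
have chi_hess : chi (teval hess_terms v) = 0.
  by rewrite rmorph_teval chiv (flex_hess five t9).
have [t1 t1E] := flex_theta five t9; have [j1 j1E] := flex_jac five t9.
have unit_num k : exists u, u * chi (pole_num (teval theta_terms v)
    (teval jac_terms v) k) = 1.
  rewrite rmorph_pole_num !rmorph_teval chiv /pole_num.
  case: ifP => _; first by exists (t1 ^+ k./2); rewrite -exprMn t1E expr1n.
  case: ifP => _; first by exists 1; rewrite mul1r.
  by exists (j1 * t1 ^+ (k - 3)./2); rewrite mulrACA j1E -exprMn t1E expr1n mulr1.
elim: m => // m IHm dvd_m.
have rm i : (i < 9)%N -> r m i = 0.
  apply: t_free.
  case: dvd_m => q /(congr1 chi); rewrite rmorphM chi_fibre mul0r /=.
  rewrite rmorphD !rmorphM chi_hess mul0r add0r.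
  have [u uE] := unit_num m => /(congr1 ( *%R u)).
  rewrite mulr0 mulrCA uE mulr1 rmorph_sum => eS; rewrite -[RHS]eS.
  apply: eq_bigr => i1 _.
  rewrite rmorphM rmorphXn chi_w; congr (_ * _); exact: esym (ev2CC _ _ _ _).
have {}dvd_m : fibre_dvd (hsum (teval hess_terms v)
    (fun k => \sum_(i < 9) (r k i)%:P%:P * w ^+ i)
    (pole_num (teval theta_terms v) (teval jac_terms v)) m).
  apply: fibre_dvd_hess; move: dvd_m => /=.
  by rewrite [X in _ + X * _]big1 ?mul0r ?addr0 // => i _; rewrite rm // !mul0r.
move=> k i; rewrite ltnS leq_eqVlt => /predU1P[->|]; first exact: rm.
exact: IHm.
Qed.

End SpecialFibre.

(** * The pencil of cubics and its generic member *)

Section Pencil.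

Variable R : comNzRingType.
Implicit Types x w : R.

(** The two affine cubics that span the pencil: the member with parameter s is
    s * pencil_denom = pencil_numer ([cubic_pencil]), so that their quotient is
    the parameter of the member through a given point. *)
Definition pencil_numer x w := - (x ^+ 3 + 3 * x + 2 * w).
Definition pencil_denom x w := w ^+ 3 - 2 * x - 1.

Lemma cubic_pencil s x w : cubic x w 1 1 s (2 * s - 3) (-2) s
  = s * pencil_denom x w - pencil_numer x w.
Proof. by rewrite /cubic /pencil_denom /pencil_numer; ring. Qed.

Lemma rmorph_pencil_numer (R' : comNzRingType) (f : {rmorphism R -> R'}) x w :
  f (pencil_numer x w) = - (f x ^+ 3 + 3 * f x + 2 * f w).
Proof.
by rewrite /pencil_numer rmorphN !rmorphD rmorphXn !rmorphM !rmorph_nat.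
Qed.

Lemma rmorph_pencil_denom (R' : comNzRingType) (f : {rmorphism R -> R'}) x w :
  f (pencil_denom x w) = f w ^+ 3 - 2 * f x - 1.
Proof.
by rewrite /pencil_denom !rmorphB rmorphXn rmorphM rmorph_nat rmorph1.
Qed.

Definition pencil_at s x w : seq R := [:: x; w; 1; 1; s; 2 * s - 3; -2; s].

Lemma rmorph_pencil_at (R' : comNzRingType) (f : {rmorphism R -> R'}) s x w :
  map f (pencil_at s x w)
  = [:: f x; f w; 1; 1; f s; 2 * f s - 3; -2; f s].
Proof. by rewrite /= rmorph1 rmorphB rmorphM rmorphN !rmorph_nat. Qed.

End Pencil.

(** In the rest of the argument x and w are algebraically independent over F_5
    in a field E, so that (x, w) is the generic point of the plane; x and w also
    generate the function field of the generic member of the pencil over k(s). *)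
Section GenericMember.

Variables (E : fieldType) (iota : {rmorphism 'F_5 -> E}) (x w : E).
Hypothesis alg_indep : forall p : poly2, ev2 iota w x p = 0 -> p = 0.

Let ev : {rmorphism poly2 -> E} := ev2 iota w x.
Let ev_indep p : ev p = 0 -> p = 0. Proof. exact: alg_indep. Qed.
Let evX : ev 'X = x. Proof. exact: ev2Y. Qed.
Let evW : ev 'X%:P = w. Proof. exact: ev2X. Qed.
Local Notation numer := (pencil_numer ('X : poly2) 'X%:P).
Local Notation denom := (pencil_denom ('X : poly2) 'X%:P).

Definition param : E := pencil_numer x w / pencil_denom x w.
Local Notation s := param.

Local Notation pencil_point := (pencil_at s x w).
Local Notation h := (teval hess_terms pencil_point).
Local Notation th := (teval theta_terms pencil_point).
Local Notation jc := (teval jac_terms pencil_point).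

Lemma fibre_numer_denom : fibre = denom - numer.
Proof. by rewrite /fibre /cubic /pencil_denom /pencil_numer; ring. Qed.

Lemma ev_numer : ev numer = pencil_numer x w.
Proof. by rewrite rmorph_pencil_numer evX evW. Qed.

Lemma ev_denom : ev denom = pencil_denom x w.
Proof. by rewrite rmorph_pencil_denom evX evW. Qed.

Lemma denom_neq0 : pencil_denom x w != 0.
Proof.
rewrite -ev_denom; apply/eqP => /ev_indep/(congr1 (ev2 idfun 0 0)).
rewrite rmorph_pencil_denom rmorph0 /= ev2X ev2Y => /eqP.
by rewrite expr0n mulr0 subr0 sub0r oppr_eq0 oner_eq0.
Qed.

Lemma ev_fibre_neq0 : ev fibre != 0.
Proof. by apply/eqP => /ev_indep/eqP; rewrite (negPf (monic_neq0 monic_fibre)). Qed.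

Lemma param_neq1 : s - 1 != 0.
Proof.
rewrite subr_eq0; apply/eqP => s1; have := ev_fibre_neq0.
rewrite fibre_numer_denom (rmorphB ev) ev_numer ev_denom subr_eq0 -[X in X != _]mul1r -s1 /param.
by rewrite divfK ?denom_neq0 ?eqxx.
Qed.

Lemma pencil_cubic : cubic x w 1 1 s (2 * s - 3) (-2) s = 0.
Proof.
by rewrite cubic_pencil divfK ?denom_neq0 ?subrr.
Qed.

Let ev3 : {rmorphism {poly poly2} -> E} := ev1 ev s.
Let ev3C p : ev3 p%:P = ev p. Proof. exact: ev1C. Qed.
Let ev3X : ev3 'X = s. Proof. exact: ev1X. Qed.

(** Division by the linear polynomial d s - n, allowing multiplication by powers
    of the leading coefficient d. *)
Lemma pseudo_divide (R : comNzRingType) (d n : R) (g : {poly R}) :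
  exists r q c, (d ^+ r)%:P * g = (d%:P * 'X - n%:P) * q + c%:P.
Proof.
elim/poly_ind: g => [|g a [r [q [c IH]]]].
  by exists 0%N, 0, 0; rewrite !mulr0 addr0.
exists r.+1, (d%:P * 'X * q + c%:P), (c * n + d ^+ r.+1 * a).
rewrite exprSr !rmorphD !rmorphM /=.
transitivity (d%:P * ((d ^+ r)%:P * g) * 'X + (d ^+ r)%:P * d%:P * a%:P);
  first by ring.
by rewrite IH; ring.
Qed.

(** A polynomial relation over k[x, w] satisfied by s is, up to a power of the
    denominator, a multiple of denom * s - numer, which becomes fibre at s = 1;
    and the denominator is not a zero divisor modulo fibre. *)
Lemma specialise (g : {poly poly2}) : ev3 g = 0 -> fibre_dvd g.[1].
Proof.
move=> g0; have [r [q [c gE]]] := pseudo_divide denom numer g.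
have evl : ev3 (denom%:P * 'X - numer%:P) = 0.
  rewrite rmorphB rmorphM !ev3C ev3X.
  by rewrite ev_numer ev_denom mulrC divfK ?denom_neq0 // subrr.
have c0 : c = 0.
  apply: ev_indep; move/(congr1 ev3): gE.
  rewrite rmorphM g0 mulr0 rmorphD rmorphM evl mul0r add0r.
  by rewrite ev3C => <-.
have {gE} : denom ^+ r * g.[1] = fibre * q.[1].
  move/(congr1 (fun p : {poly poly2} => p.[1])): gE; rewrite c0.
  by rewrite !hornerE fibre_numer_denom.
elim: r q => [|r IH] q; first by rewrite expr0 mul1r; exists q.[1].
rewrite exprS -mulrA => e; suff [q' q'E] : fibre_dvd (denom ^+ r * g.[1]).
  by apply: (IH q'%:P); rewrite hornerC.
by apply: fibre_dvd_denom; exists q.[1].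
Qed.

(** The generic member with s replaced by an independent variable, in which the
    value s = 1 can be substituted. *)
Local Notation lifted_point := (pencil_at ('X : {poly poly2}) 'X%:P 'X%:P%:P).

Lemma ev3_lifted l : ev3 (teval l lifted_point) = teval l pencil_point.
Proof. by rewrite rmorph_teval rmorph_pencil_at !ev3C ev3X evX evW. Qed.

Lemma lifted_at1 l : (teval l lifted_point).[1]
  = teval l [:: 'X; 'X%:P; 1; 1; 1; -1; -2; 1].
Proof.
rewrite -[LHS]/(horner_eval 1 _) rmorph_teval rmorph_pencil_at /=.
rewrite ![horner_eval _ _%:P]hornerC [horner_eval _ 'X]hornerX.
by rewrite (_ : 2 * 1 - 3 = -1) //; ring.
Qed.

Lemma hess_neq0 : h != 0.
Proof.
apply/eqP; rewrite -ev3_lifted => /specialise; rewrite lifted_at1 => d.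
have [q] : fibre_dvd 1 by apply: fibre_dvd_hess; rewrite mulr1.
have [->|q0] := eqVneq q 0; first by rewrite mulr0 => /eqP; rewrite oner_eq0.
move/(congr1 (fun p : poly2 => size p)); rewrite size_poly1.
rewrite size_monicM ?monic_fibre // size_fibre.
by move: q0; rewrite -size_poly_gt0; case: (size _).
Qed.

(** The relation at s = 1 is trivial by [fibre_free], so all coefficients are
    divisible by s - 1; divide and conclude by induction on a bound on their
    degrees. *)
Lemma hsum_free m (r : nat -> nat -> {poly 'F_5}) :
  hsum h (fun k => \sum_(i < 9) ev1 iota s (r k i) * w ^+ i)
    (pole_num th jc) m = 0 ->
  forall k i, (k < m)%N -> (i < 9)%N -> r k i = 0.
Proof.
have bnd : forall k i, (k < m)%N -> (i < 9)%N ->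
    (size (r k i) <= \max_(k < m) \max_(i < 9) size (r k i))%N.
  move=> k i km i9; apply: leq_trans (leq_bigmax (Ordinal km)) => /=.
  exact: (leq_bigmax (F := fun i : 'I_9 => size (r k i)) (Ordinal i9)).
move: (\max_(_ < _) _) bnd => L; elim: L r => [|L IH] r bnd r0 k i km i9.
  by apply/eqP; rewrite -size_poly_leq0 bnd.
have r1 : forall k i, (k < m)%N -> (i < 9)%N -> (r k i).[1] = 0.
  pose lift (p : {poly 'F_5}) : {poly poly2} := map_poly (polyC \o polyC) p.
  have lift_at1 p : (lift p).[1] = p.[1]%:P%:P.
    exact: (horner_map (polyC \o polyC : {rmorphism 'F_5 -> poly2}) p 1).
  have ev3_lift p : ev3 (lift p) = ev1 iota s p.
    rewrite /= /ev1 /horner_morph /lift -map_poly_comp; congr _.[_].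
    by apply: eq_map_poly => c /=; rewrite ev2CC.
  apply: fibre_free.
  pose g := hsum (teval hess_terms lifted_point)
    (fun k => \sum_(i < 9) lift (r k i) * 'X%:P%:P ^+ i)
    (pole_num (teval theta_terms lifted_point) (teval jac_terms lifted_point)) m.
  suff : fibre_dvd g.[1].
    move=> g1; refine (eq_ind _ fibre_dvd g1 _ _).
    pose at1 : {rmorphism {poly poly2} -> poly2} := horner_eval (1 : poly2).
    have at1C p : at1 p%:P = p by exact: hornerC.
    have at1_lifted l : at1 (teval l lifted_point)
      = teval l [:: 'X; 'X%:P; 1; 1; 1; -1; -2; 1] by exact: lifted_at1.
    have at1_lift p : at1 (lift p) = p.[1]%:P%:P by exact: lift_at1.
    rewrite -[g.[1]]/(at1 g) rmorph_hsum at1_lifted.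
    apply: eq_hsum => k' _ /=.
    rewrite rmorph_pole_num !at1_lifted; congr (_ * _).
    rewrite rmorph_sum; apply: eq_bigr => i' _.
    by rewrite rmorphM rmorphXn at1_lift at1C.
  apply: specialise; rewrite rmorph_hsum ev3_lifted -[RHS]r0.
  apply: eq_hsum => k' _; rewrite [in LHS]/comp rmorph_pole_num !ev3_lifted.
  congr (_ * _); rewrite rmorph_sum; apply: eq_bigr => i' _.
  by rewrite rmorphM rmorphXn ev3_lift ev3C evW.
pose r' k i := r k i %/ ('X - 1%:P).
have rE : forall k i, (k < m)%N -> (i < 9)%N -> r k i = r' k i * ('X - 1%:P).
  move=> k' i' km' i9'; rewrite /r' divpK // dvdp_XsubCl.
  by apply/rootP/r1.
have r'0 : forall k i, (k < m)%N -> (i < 9)%N -> r' k i = 0.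
  apply: IH => [k' i' km' i9'|].
    rewrite size_divp ?polyXsubC_eq0 // size_XsubC /= leq_subLR.
    by rewrite add1n bnd.
  have : (s - 1) * hsum h (fun k => \sum_(i < 9) ev1 iota s (r' k i) * w ^+ i)
    (pole_num th jc) m = 0.
    rewrite -hsumZ -[RHS]r0; apply: eq_hsum => k' km'; congr (_ * _).
    rewrite mulr_sumr; apply: eq_bigr => i' _.
    by rewrite rE // rmorphM rmorphB /= ev1X ev1C rmorph1; ring.
  by move/eqP; rewrite mulf_eq0 (negPf param_neq1) => /eqP.
by rewrite rE // r'0 // mul0r.
Qed.

End GenericMember.

(** * The affine ring of the surface inside the function field of the plane *)

(** The syzygy modulo 5 for the coefficients c = 1, a = 2 t - 3, b = -2, g = t of
    the pencil. *)
Definition weierstrass_rhs (R : comNzRingType) (t z : R) : R :=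
  z ^+ 3 + 2 * t * (2 * t - 3) * (- 2) * z
  + (2 * t ^+ 4 + t * (- 2) ^+ 3 + t ^+ 2 * (2 * t - 3) ^+ 3).

Lemma rmorph_weierstrass_rhs (R R' : comNzRingType) (f : {rmorphism R -> R'}) t z :
  f (weierstrass_rhs t z) = weierstrass_rhs (f t) (f z).
Proof.
by rewrite /weierstrass_rhs
  !(rmorphXn, rmorph_nat, rmorphD, rmorphN, rmorphM).
Qed.

Lemma big_ord_double (R : nmodType) m (F : nat -> R) :
  \sum_(k < m.*2) F k = \sum_(j < m) F j.*2 + \sum_(j < m) F j.*2.+1.
Proof.
elim: m => [|m IH]; first by rewrite !big_ord0 addr0.
by rewrite doubleS !big_ord_recr /= IH -!addrA; congr (_ + _); rewrite addrCA.
Qed.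

Section QuadraticExtension.

Variables (A R : comNzRingType) (f : {rmorphism A -> R}) (y : R).

Definition quad (P Q : A) := f P + y * f Q.

Lemma quad0 : quad 0 0 = 0.
Proof. by rewrite /quad !rmorph0 mulr0 addr0. Qed.

Lemma quadl P : quad P 0 = f P.
Proof. by rewrite /quad rmorph0 mulr0 addr0. Qed.

Lemma quadr : quad 0 1 = y.
Proof. by rewrite /quad rmorph0 rmorph1 mulr1 add0r. Qed.

Lemma quadN P Q : - quad P Q = quad (- P) (- Q).
Proof. by rewrite /quad !rmorphN opprD mulrN. Qed.

Lemma quadD P Q P' Q' : quad P Q + quad P' Q' = quad (P + P') (Q + Q').
Proof. by rewrite /quad !rmorphD; ring. Qed.

Lemma quadM W P Q P' Q' : y ^+ 2 = f W ->
  quad P Q * quad P' Q' = quad (P * P' + W * Q * Q') (P * Q' + Q * P').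
Proof.
by rewrite /quad => yW; rewrite !rmorphD !rmorphM /= -yW; ring.
Qed.

End QuadraticExtension.

Section SurfaceRing.

Variables (E : fieldType) (iota : {rmorphism 'F_5 -> E}) (x w : E).
Hypothesis alg_indep : forall p : poly2, ev2 iota w x p = 0 -> p = 0.

Let ev : {rmorphism poly2 -> E} := ev2 iota w x.
Let evX : ev 'X = x. Proof. exact: ev2Y. Qed.
Let evW : ev 'X%:P = w. Proof. exact: ev2X. Qed.

Local Notation s := (param x w).
Local Notation h := (teval hess_terms (pencil_at s x w)).
Local Notation th := (teval theta_terms (pencil_at s x w)).
Local Notation jc := (teval jac_terms (pencil_at s x w)).

Let h0 : h != 0. Proof. exact: hess_neq0 alg_indep. Qed.

Definition coordX : E := th / h ^+ 2.
Definition coordY : E := jc / h ^+ 3.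
Local Notation X := coordX.
Local Notation Y := coordY.

(** The monomial in X, Y with a pole of order k along the flexes, up to the
    filler 1 / h at k = 1. *)
Definition pole k : E := pole_num th jc k / h ^+ k.

Lemma pole_even j : pole j.*2 = X ^+ j.
Proof.
by rewrite /pole /pole_num odd_double doubleK /X expr_div_n -exprM mul2n.
Qed.

Lemma pole_odd j : pole j.+1.*2.+1 = X ^+ j * Y.
Proof.
rewrite /pole /pole_num /= odd_double /= (_ : (j.+1.*2.+1 - 3)./2 = j); last by lia.
have -> : h ^+ j.+1.*2.+1 = (h ^+ 2) ^+ j * h ^+ 3.
  by rewrite -exprM -exprD; congr (_ ^+ _); lia.
by rewrite /X /Y expr_div_n invfM; ring.
Qed.

Lemma five_field : 5 = 0 :> E.
Proof.
by rewrite -(rmorph_nat iota) (_ : 5 = 0 :> 'F_5) ?rmorph0 //; apply/eqP.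
Qed.

Lemma weierstrass : Y ^+ 2 = weierstrass_rhs s X.
Proof.
have := covariant_syzygy5 five_field (pencil_cubic alg_indep).
rewrite -/(pencil_at s x w) /weierstrass_rhs /X /Y => e.
by apply: (mulIf (expf_neq0 6 h0)); rewrite expr_div_n -exprM divfK ?expf_neq0 // e; field.
Qed.

Lemma pole_free m (r : nat -> nat -> {poly 'F_5}) :
  \sum_(k < m) (\sum_(i < 9) ev1 iota s (r k i) * w ^+ i) * pole k = 0 ->
  forall k i, (k < m)%N -> (i < 9)%N -> r k i = 0.
Proof.
move=> e; apply: (hsum_free alg_indep); apply: (mulfI h0).
by rewrite hsumE // mulr0 e mulr0.
Qed.

Let evS : {rmorphism poly2 -> E} := ev2 iota s X.

Definition ev_surface (P Q : poly2) : E := quad evS Y P Q.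

(** The coefficients of P(X) + Y Q(X) listed by order of pole: X^j has order 2 j
    and X^j Y has order 2 j + 3, so these orders are all distinct. *)
Definition pole_coef (P Q : poly2) (k : nat) : {poly 'F_5} :=
  if ~~ odd k then P`_k./2 else if k == 1%N then 0 else Q`_(k - 3)./2.

Lemma pole_coef_even P Q j : pole_coef P Q j.*2 = P`_j.
Proof. by rewrite /pole_coef odd_double doubleK. Qed.

Lemma pole_coef_odd P Q j : pole_coef P Q j.+1.*2.+1 = Q`_j.
Proof.
rewrite /pole_coef /= odd_double /= (_ : (j.+1.*2.+1 - 3)./2 = j) //; lia.
Qed.

Lemma ev_surface_pole N (P Q : poly2) : (size P <= N)%N -> (size Q <= N)%N ->
  ev_surface P Q
    = \sum_(k < N.+1.*2) ev1 iota s (pole_coef P Q k) * pole k.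
Proof.
move=> sP sQ; rewrite (big_ord_double _ (fun k => _ (pole_coef P Q k) * pole k)).
rewrite /ev_surface /quad /= /ev2; congr (_ + _).
  rewrite big_ord_recr /= pole_coef_even nth_default // rmorph0 mul0r addr0.
  rewrite (@ev1E _ _ _ _ _ N) //; apply: eq_bigr => j _.
  by rewrite pole_coef_even pole_even.
rewrite big_ord_recl /= rmorph0 mul0r add0r (@ev1E _ _ _ _ _ N) // mulr_sumr.
apply: eq_bigr => j _; rewrite -[bump 0 j]/(j.+1) pole_coef_odd pole_odd.
by rewrite /= mulrCA [Y * _]mulrC.
Qed.

(** The lower bound 9 for the degree: a relation between 1, w, ..., w^8 over
    k[s, X] + Y k[s, X], sorted by order of pole, is one excluded by
    [pole_free]. *)
Lemma ev_surface_free (P Q : nat -> poly2) :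
  \sum_(i < 9) ev_surface (P i) (Q i) * w ^+ i = 0 ->
  forall i, (i < 9)%N -> P i = 0 /\ Q i = 0.
Proof.
pose N := \max_(i < 9) maxn (size (P i)) (size (Q i)).
have bnd i : (i < 9)%N -> (size (P i) <= N)%N /\ (size (Q i) <= N)%N.
  move=> i9; have := leq_bigmax (F := fun i : 'I_9 =>
    maxn (size (P i)) (size (Q i))) (Ordinal i9).
  by rewrite /= geq_max => /andP.
pose r k i := pole_coef (P i) (Q i) k.
move=> e; have r0 : forall k i, (k < N.+1.*2)%N -> (i < 9)%N -> r k i = 0.
  apply: pole_free; rewrite -[RHS]e.
  under eq_bigr => k _ do rewrite mulr_suml.
  rewrite exchange_big; apply: eq_bigr => i _ /=.
  have [sP sQ] := bnd i (ltn_ord i).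
  rewrite (ev_surface_pole sP sQ) mulr_suml; apply: eq_bigr => k _.
  by rewrite -/(r k i) mulrAC.
move=> i i9; have [sP sQ] := bnd i i9; split; apply/polyP => j; rewrite coef0.
  have [jN|Nj] := ltnP j N; last by rewrite nth_default // (leq_trans sP).
  by rewrite -(pole_coef_even _ (Q i)); apply: r0; rewrite // ltn_double ltnW.
have [jN|Nj] := ltnP j N; last by rewrite nth_default // (leq_trans sQ).
by rewrite -(pole_coef_odd (P i)); apply: r0 => //; lia.
Qed.

Lemma ev_surface_eq0 P Q : ev_surface P Q = 0 -> P = 0 /\ Q = 0.
Proof.
move=> e; apply: (@ev_surface_free (fun i => if i == 0%N then P else 0)
  (fun i => if i == 0%N then Q else 0) _ 0%N) => //.
rewrite big_ord_recl big1 => [|i _]; first by rewrite e mul0r addr0.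
by rewrite /ev_surface /= quad0 mul0r.
Qed.

Definition surface_ring (z : E) : Prop := exists P Q, z = ev_surface P Q.

Lemma surface_ringC c : surface_ring (iota c).
Proof. by exists c%:P%:P, 0; rewrite /ev_surface quadl -(ev2CC iota s X). Qed.

Lemma surface_ring_s : surface_ring s.
Proof. by exists 'X%:P, 0; rewrite /ev_surface quadl -[LHS](ev2X iota s X). Qed.

Lemma surface_ring_X : surface_ring X.
Proof. by exists 'X, 0; rewrite /ev_surface quadl -[LHS](ev2Y iota s X). Qed.

Lemma surface_ring_Y : surface_ring Y.
Proof. by exists 0, 1; rewrite /ev_surface quadr. Qed.

Lemma surface_ringD y z : surface_ring y -> surface_ring z -> surface_ring (y + z).
Proof.
by move=> [P [Q ->]] [P' [Q' ->]]; exists (P + P'), (Q + Q'); exact: quadD.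
Qed.

Lemma surface_ringN y : surface_ring y -> surface_ring (- y).
Proof. by move=> [P [Q ->]]; exists (- P), (- Q); exact: quadN. Qed.

Lemma surface_ringM y z : surface_ring y -> surface_ring z -> surface_ring (y * z).
Proof.
move=> [P [Q ->]] [P' [Q' ->]].
have YW : Y ^+ 2 = evS (weierstrass_rhs 'X%:P 'X).
  rewrite rmorph_weierstrass_rhs weierstrass; congr weierstrass_rhs.
    by rewrite -[LHS](ev2X iota s X).
  by rewrite -[LHS](ev2Y iota s X).
by rewrite /ev_surface (quadM _ _ _ _ YW); do 2 eexists.
Qed.

Lemma surface_ring1 : surface_ring 1.
Proof. by rewrite -(rmorph1 iota); apply: surface_ringC. Qed.

Lemma surface_ringB y z : surface_ring y -> surface_ring z -> surface_ring (y - z).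
Proof. by move=> Ry Rz; apply/surface_ringD/surface_ringN. Qed.

Lemma powers_free (c : 'I_9 -> E) : (forall i, fraction_of surface_ring (c i)) ->
  \sum_i c i * w ^+ i = 0 -> forall i, c i = 0.
Proof.
move=> /(common_denominator surface_ring1 surface_ringM)[b [Rb b0]].
move=> /fin_all_exists[P /fin_all_exists[Q bc]] e.
pose P' i := P (inord i); pose Q' i := Q (inord i).
have PQ0 := @ev_surface_free P' Q'; move=> i; apply: (mulfI b0).
have [|P0 Q0] := PQ0 _ i (ltn_ord i).
  rewrite -[RHS](mulr0 b) -[X in _ = b * X]e mulr_sumr; apply: eq_bigr => k _.
  by rewrite mulrA bc /P' /Q' inord_val.
rewrite bc mulr0; move: P0 Q0; rewrite /P' /Q' inord_val => -> ->.
exact: quad0.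
Qed.

End SurfaceRing.

(** * Ten functions on the plane are dependent *)

Section Counting.

Variables (E : fieldType) (iota : {rmorphism 'F_5 -> E}) (x w : E).
Hypothesis alg_indep : forall p : poly2, ev2 iota w x p = 0 -> p = 0.

Let ev : {rmorphism poly2 -> E} := ev2 iota w x.
Let evX : ev 'X = x. Proof. exact: ev2Y. Qed.
Let evC p : ev p%:P = ev1 iota w p. Proof. exact: ev2C. Qed.

Local Notation s := (param x w).
Local Notation h := (teval hess_terms (pencil_at s x w)).
Local Notation th := (teval theta_terms (pencil_at s x w)).
Local Notation jc := (teval jac_terms (pencil_at s x w)).
Local Notation surface_ring := (surface_ring iota x w).
Local Notation pole := (pole x w).

(** The polynomials in x, w, s of degree at most n in (x, w) and at most l in s.
    The cubic expresses x^3 through lower powers of x, at the cost of one power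
    of s ([x_cube]), so that three powers of x suffice and the dimension grows
    like 3 n l, the degree of a plane cubic being 3. *)
Inductive bounded (n l : nat) : E -> Prop :=
| BoundedMonom i j k : (i < 3)%N -> (i + j <= n)%N -> (k <= l)%N ->
    bounded n l (x ^+ i * w ^+ j * s ^+ k)
| Bounded0 : bounded n l 0
| BoundedD y z : bounded n l y -> bounded n l z -> bounded n l (y + z)
| BoundedZ c z : bounded n l z -> bounded n l (iota c * z).

Lemma bounded_le n l n' l' z : (n <= n')%N -> (l <= l')%N ->
  bounded n l z -> bounded n' l' z.
Proof.
move=> nn ll; elim=> [i j k i3 ijn kl||y y' _ By _ By'|c y _ By].
- by apply: BoundedMonom => //; [apply: leq_trans nn | apply: leq_trans ll].
- exact: Bounded0.
- exact: BoundedD.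
- exact: BoundedZ.
Qed.

Lemma bounded_span n l z : bounded n l z ->
  exists v : 'I_3 * 'I_n.+1 * 'I_l.+1 -> 'F_5,
    z = \sum_b iota (v b) * (x ^+ b.1.1 * w ^+ b.1.2 * s ^+ b.2).
Proof.
elim=> [i j k i3 ijn kl||y y' _ [v ->] _ [v' ->]|c y _ [v ->]].
- have jn : (j < n.+1)%N by rewrite ltnS; apply: leq_trans (leq_addl _ _) ijn.
  pose b : 'I_3 * 'I_n.+1 * 'I_l.+1 :=
    (Ordinal i3, Ordinal jn, Ordinal (kl : (k < l.+1)%N)).
  exists (fun b' => (b' == b)%:R).
  rewrite (bigD1 b) //= eqxx rmorph1 mul1r big1 ?addr0 // => b' /negPf ->.
  by rewrite rmorph0 mul0r.
- by exists (fun=> 0); rewrite big1 // => b _; rewrite rmorph0 mul0r.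
- exists (fun b => v b + v' b); rewrite -big_split; apply: eq_bigr => b _ /=.
  by rewrite rmorphD mulrDl.
- exists (fun b => c * v b); rewrite mulr_sumr; apply: eq_bigr => b _.
  by rewrite rmorphM mulrA.
Qed.

(** A filtered version of being a polynomial of degree a in (x, w) and b in s,
    stable under products and sums. *)
Definition raises (a b : nat) (f : E) : Prop :=
  forall n l z, bounded n l z -> bounded (n + a) (l + b) (f * z).

Lemma raises_le a b a' b' f : (a <= a')%N -> (b <= b')%N ->
  raises a b f -> raises a' b' f.
Proof.
move=> aa bb Rf n l z /Rf; apply: bounded_le; rewrite leq_add2l //.
Qed.

Lemma raises_iota c : raises 0 0 (iota c).
Proof. by move=> n l z; rewrite !addn0; apply: BoundedZ. Qed.

Lemma raises1 : raises 0 0 1.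
Proof. by rewrite -(rmorph1 iota); apply: raises_iota. Qed.

Lemma raisesM a b a' b' f g : raises a b f -> raises a' b' g ->
  raises (a + a') (b + b') (f * g).
Proof.
move=> Rf Rg n l z Bz; rewrite -mulrA [(a + _)%N]addnC [(b + _)%N]addnC !addnA.
exact/Rf/Rg.
Qed.

Lemma raisesX a b f k : raises a b f -> raises (k * a) (k * b) (f ^+ k).
Proof.
by move=> Rf; elim: k => [|k IH]; [apply: raises1 | rewrite exprS; apply: raisesM].
Qed.

Lemma raisesD a b f g : raises a b f -> raises a b g -> raises a b (f + g).
Proof. by move=> Rf Rg n l z Bz; rewrite mulrDl; apply: BoundedD; auto. Qed.

Lemma raises_w : raises 1 0 w.
Proof.
move=> n l z; elim=> [i j k i3 ijn kl||y y' _ By _ By'|c y _ By].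
- rewrite (_ : _ * _ = x ^+ i * w ^+ j.+1 * s ^+ k); last by rewrite exprS; ring.
  by apply: BoundedMonom; rewrite ?addn0 // addnS addn1 ltnS.
- by rewrite mulr0; apply: Bounded0.
- by rewrite mulrDr; apply: BoundedD.
- by rewrite mulrCA; apply: BoundedZ.
Qed.

Lemma raises_s : raises 0 1 s.
Proof.
move=> n l z; elim=> [i j k i3 ijn kl||y y' _ By _ By'|c y _ By].
- rewrite (_ : _ * _ = x ^+ i * w ^+ j * s ^+ k.+1); last by rewrite exprS; ring.
  by apply: BoundedMonom; rewrite ?addn0 // addn1 ltnS.
- by rewrite mulr0; apply: Bounded0.
- by rewrite mulrDr; apply: BoundedD.
- by rewrite mulrCA; apply: BoundedZ.
Qed.

Lemma x_cube : x ^+ 3 = iota (- 3) * x + iota (- 2) * w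
  + (iota (-1) * (s * w ^+ 3) + iota 2 * (s * x)) + s.
Proof.
have := pencil_cubic alg_indep; rewrite cubic_pencil /pencil_numer /pencil_denom.
rewrite !rmorphN !rmorph_nat rmorph1 => e.
transitivity (s * (w ^+ 3 - 2 * x - 1) - (- (x ^+ 3 + 3 * x + 2 * w))
  + (- 3 * x - 2 * w - s * (w ^+ 3 - 2 * x - 1))); first by ring.
by rewrite e; ring.
Qed.

Lemma raises_x : raises 1 1 x.
Proof.
move=> n l z; elim=> [i j k i3 ijn kl||y y' _ By _ By'|c y _ By].
- have [i2|i2] := ltnP i 2.
    rewrite (_ : _ * _ = x ^+ i.+1 * w ^+ j * s ^+ k); last by rewrite exprS; ring.
    by apply: BoundedMonom; rewrite ?addn1 ?addSn // leqW.
  have i_2 : i = 2%N by lia.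
  rewrite {i i3 i2}i_2 in ijn *.
  pose mon i j k := x ^+ i * w ^+ j * s ^+ k.
  have -> : x * (x ^+ 2 * w ^+ j * s ^+ k) =
      iota (- 3) * mon 1%N j k + iota (- 2) * mon 0%N j.+1 k
    + (iota (-1) * mon 0%N (j + 3)%N k.+1 + iota 2 * mon 1%N j k.+1)
    + mon 0%N j k.+1.
    rewrite /mon !exprS exprD; transitivity (x ^+ 3 * (w ^+ j * s ^+ k)).
      by ring.
    by rewrite x_cube; ring.
  have mon_bd i' j' k' : (i' < 3)%N -> (i' + j' <= n.+1)%N -> (k' <= l.+1)%N ->
      bounded (n + 1) (l + 1) (mon i' j' k').
    by rewrite !addn1; exact: BoundedMonom.
  do ?[apply: BoundedD | apply: BoundedZ]; apply: mon_bd => //; lia.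
- by rewrite mulr0; apply: Bounded0.
- by rewrite mulrDr; apply: BoundedD.
- by rewrite mulrCA; apply: BoundedZ.
Qed.

Fixpoint weight (d e : seq nat) : nat :=
  if d is a :: d' then if e is i :: e' then (i * a + weight d' e')%N else 0%N
  else 0%N.

Fixpoint raises_all (v : seq E) (da db : seq nat) : Prop :=
  match v, da, db with
  | [::], _, _ => True
  | y :: v', a :: da', b :: db' => raises a b y /\ raises_all v' da' db'
  | _, _, _ => False
  end.

Lemma raises_monom v da db e : raises_all v da db ->
  raises (weight da e) (weight db e) (monom v e).
Proof.
elim: v da db e => [|y v IH] [|a da] [|b db] [|i e] //=; try by move=> _; apply: raises1.
- by move=> _; apply: raises_le (raises1).
- by move=> _; apply: raises_le (raises1).
- by move=> _; apply: raises_le (raises1).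
by case=> Ry Rv; apply: raisesM; [apply: raisesX | apply: IH].
Qed.

Lemma raises_teval a b v da db (l : seq term) : raises_all v da db ->
  all (fun '(Term _ e) => (weight da e <= a)%N && (weight db e <= b)%N) l ->
  raises a b (teval l v).
Proof.
move=> Rv; rewrite /teval; elim: l => [_|[z e] l IH /= /andP[/andP[ea eb] /IH Rl]].
  by apply: raises_le (leq0n a) (leq0n b) _; rewrite -(rmorph0 iota); apply: raises_iota.
apply: raisesD Rl; rewrite -(rmorph_integerR iota).
by apply: raisesM (raises_iota _) (raises_le ea eb _); apply: raises_monom.
Qed.

Lemma raises_pencil :
  raises_all (pencil_at s x w) [:: 1; 1; 0; 0; 0; 0; 0; 0]%N
    [:: 1; 0; 0; 0; 1; 1; 0; 1]%N.
Proof.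
have Rc n : raises 0 0 (n%:R : E) by rewrite -(rmorph_nat iota); apply: raises_iota.
have RN n : raises 0 0 (- n%:R : E).
  by rewrite -(rmorph_nat iota) -rmorphN; apply: raises_iota.
rewrite /=; do !split => //; do ?[exact: raises_x | exact: raises_w
  | exact: raises_s | exact: (Rc 1%N) | exact: (RN 2%N)].
apply: raisesD; first exact: (raisesM (Rc 2%N) raises_s).
exact: raises_le (RN 3%N).
Qed.

(* The bounds for hess, theta and jac are (3, 7) times 1, 2 and 3, so that the
   numerator of a pole of order k has the bounds (3 k, 7 k) of hess^k. *)
Lemma raises_hess : raises 3 7 h.
Proof. exact: raises_teval raises_pencil _. Qed.

Lemma raises_pole_num k : raises (k * 3) (k * 7) (pole_num th jc k).
Proof.
have Rt : raises 6 14 th by apply: raises_teval raises_pencil _.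
have Rj : raises 9 21 jc by apply: raises_teval raises_pencil _.
have k2 := odd_double_half k; rewrite /pole_num; case: ifP => [/negbTE|/negbFE] ok.
  apply: raises_le (raisesX k./2 Rt); move: k2; rewrite ok; lia.
case: eqP => [->|k1]; first exact: raises_le raises1.
apply: raises_le (raisesM Rj (raisesX (k - 3)./2 Rt)); move: k2; rewrite ok; lia.
Qed.

Lemma raises_ev (p : poly2) : exists a b, raises a b (ev p).
Proof.
have R0 : raises 0 0 0 by rewrite -(rmorph0 iota); apply: raises_iota.
have RD a b a' b' f g : raises a b f -> raises a' b' g ->
    raises (a + a') (b + b') (f + g).
  move=> Rf Rg; apply: raisesD.
    by apply: raises_le Rf; rewrite leq_addr.
  by apply: raises_le Rg; rewrite leq_addl.
have R1 (q : {poly 'F_5}) : exists a b, raises a b (ev1 iota w q).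
  elim/poly_ind: q => [|q c [a [b IH]]]; first by exists 0%N, 0%N; rewrite rmorph0.
  rewrite rmorphD rmorphM /= ev1C ev1X.
  by do 2 eexists; apply: RD (raisesM IH raises_w) (raises_iota c).
elim/poly_ind: p => [|q c [a [b IH]]]; first by exists 0%N, 0%N; rewrite rmorph0.
have [a' [b' Rc]] := R1 c; rewrite rmorphD rmorphM evX evC.
by do 2 eexists; apply: RD (raisesM IH raises_x) Rc.
Qed.

Lemma surface_ring_pole k : k != 1%N -> surface_ring (pole k).
Proof.
have RX j : surface_ring (coordX x w ^+ j).
  elim: j => [|j IH]; first exact: surface_ring1.
  by rewrite exprS; apply: (surface_ringM alg_indep) => //; apply: surface_ring_X.
have k2 := odd_double_half k; case: (boolP (odd k)) k2 => ok k2 k1.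
  have -> : k = (k./2.-1).+1.*2.+1 by lia.
  by rewrite (pole_odd alg_indep); apply: (surface_ringM alg_indep) => //; apply: surface_ring_Y.
by rewrite -k2 add0n pole_even.
Qed.

Lemma surface_ring_ev1 p : surface_ring (ev1 iota s p).
Proof.
elim/poly_ind: p => [|q c IH].
  by rewrite rmorph0 -(rmorph0 iota); apply: surface_ringC.
rewrite rmorphD rmorphM /= ev1C ev1X; apply: surface_ringD.
  by apply: (surface_ringM alg_indep) => //; apply: surface_ring_s.
exact: surface_ringC.
Qed.

(** The orders of poles 0, 2, 3, 4, ... that occur in the affine ring. *)
Definition skip1 k : nat := if k is 0 then 0 else k.+1.

Lemma pole_free_skip1 m (r : nat -> {poly 'F_5}) :
  \sum_(k < m) ev1 iota s (r k) * pole (skip1 k) = 0 ->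
  forall k, (k < m)%N -> r k = 0.
Proof.
case: m => [//|m] e k km.
pose r' k i := if (i != 0)%N then 0 else
  if k is k'.+1 then if k' is 0 then 0 else r k' else r 0%N.
have r'0 : forall k i, (k < m.+2)%N -> (i < 9)%N -> r' k i = 0.
  apply: (pole_free alg_indep); rewrite -[RHS]e.
  have inner k' : \sum_(i < 9) ev1 iota s (r' k' i) * w ^+ i = ev1 iota s (r' k' 0%N).
    rewrite big_ord_recl big1 => [|i _]; first by rewrite mulr1 addr0.
    by rewrite /r' /= rmorph0 mul0r.
  under eq_bigr => k' _ do rewrite inner.
  rewrite !big_ord_recl /= {1 2}/r' /= rmorph0 mul0r add0r; congr (_ + _).
case: k km => [|k] km; first exact: (r'0 0%N 0%N).
exact: (r'0 k.+2 0%N).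
Qed.

Definition plane_ring (z : E) : Prop := exists p, z = ev p.

Lemma plane_ring1 : plane_ring 1.
Proof. by exists 1; rewrite rmorph1. Qed.

Lemma plane_ringM y z : plane_ring y -> plane_ring z -> plane_ring (y * z).
Proof. by move=> [p ->] [q ->]; exists (p * q); rewrite rmorphM. Qed.

Lemma raises_family n (A : 'I_n -> E) : (forall i, plane_ring (A i)) ->
  exists a b, forall i, raises a b (A i).
Proof.
move=> RA; have /fin_all_exists[a /fin_all_exists[b ab]] :
    forall i, exists a b, raises a b (A i).
  by move=> i; have [p ->] := RA i; apply: raises_ev.
exists (\max_i a i), (\max_i b i) => i.
by apply: raises_le (ab i); apply: leq_bigmax.
Qed.

(** The count: the products A_i * pole * s^l with pole orders up to m and l up to
    L number 10 m (L + 1); multiplied by h^m they lie in a space of dimension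
    3 (a + 3 m + 1) (L + d + 1), where (a, b) bounds the degrees of the A_i and
    d = b + 7 m is the degree in s of the factors other than s^l.  A linear
    relation over F_5 between them, grouped by i, is the relation sought, and
    its coefficients are not all zero because the poles are independent. *)
Lemma plane_dependent_ring (A : 'I_10 -> E) : (forall i, plane_ring (A i)) ->
  exists c : 'I_10 -> E, [/\ forall i, surface_ring (c i), exists i, c i != 0
    & \sum_i c i * A i = 0].
Proof.
move=> /raises_family[a [b Aab]].
(* Let D = 3 (a + 3 m + 1), which is less than 10 m by the choice of m.  As
   L = D d, the dimension is D (L + d + 1) = D (L + 1) + L < (D + 1) (L + 1). *)
pose m := (3 * a).+4; pose d := (b + m * 7)%N.
pose L := (3 * (a + m * 3).+1 * d)%N.
pose e (q : 'I_10 * 'I_m * 'I_L.+1) : E :=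
  A q.1.1 * (pole_num th jc (skip1 q.1.2) * h ^+ (m - skip1 q.1.2)) * s ^+ q.2.
have sk (k : 'I_m) : (skip1 k <= m)%N by case: k => [[|k] ltk] /=.
have eE (q : 'I_10 * 'I_m * 'I_L.+1) : bounded (a + m * 3) (L + d) (e q).
  have s0 : bounded 0 L (s ^+ q.2).
    have := @BoundedMonom 0 L 0 0 q.2; rewrite !expr0 !mul1r; apply => //.
    by rewrite -ltnS.
  have Rm : raises (m * 3) (m * 7) (pole_num th jc (skip1 q.1.2)
      * h ^+ (m - skip1 q.1.2)).
    apply: raises_le (raisesM (raises_pole_num _) (raisesX _ raises_hess));
      by rewrite -mulnDl subnKC // sk.
  by have := raisesM (Aab q.1.1) Rm s0.
pose mon (q : 'I_3 * 'I_(a + m * 3).+1 * 'I_(L + d).+1) : E :=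
  x ^+ q.1.1 * w ^+ q.1.2 * s ^+ q.2.
have [||c [[q0 cq0] sumc]] := @dependent_of_span _ _ iota _ _ e mon.
- by move=> q; apply: bounded_span.
- rewrite !card_prod !card_ord -[X in (_ < X)%N]mulnA.
  have : (9 * m + 3 * a + 3 < 10 * m)%N by rewrite /m; lia.
  rewrite /L; move: (m) (d) => m' d'; nia.
pose R i k : {poly 'F_5} := \poly_(l < L.+1) c (i, inord k, inord l).
have RE i (k : 'I_m) : ev1 iota s (R i k)
    = \sum_(l < L.+1) iota (c (i, k, l)) * s ^+ l.
  rewrite (@ev1E _ _ _ _ _ L.+1) ?size_poly //; apply: eq_bigr => l _.
  by rewrite coef_poly ltn_ord !inord_val.
pose c' i := \sum_(k < m) ev1 iota s (R i k) * pole (skip1 k).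
exists c'; split.
- move=> i; apply: (big_ind (fun z => surface_ring z)).
  + by rewrite -(rmorph0 iota); apply: surface_ringC.
  + by move=> y z; apply: surface_ringD.
  + move=> k _; apply: (surface_ringM alg_indep); first exact: surface_ring_ev1.
    by apply: surface_ring_pole; case: k => [[|k] ltk].
- exists q0.1.1; apply: contraNneq cq0 => /pole_free_skip1 /(_ q0.1.2 (ltn_ord _)).
  move/(congr1 (coefp q0.2)); rewrite /= coef_poly ltn_ord coef0 !inord_val.
  by case: q0 => [[i k] l] /= ->.
have h0 := hess_neq0 alg_indep.
apply: (mulfI (expf_neq0 m h0)); rewrite mulr0 -[RHS]sumc.
have sum3 (F : 'I_10 * 'I_m * 'I_L.+1 -> E) :
    \sum_q F q = \sum_i \sum_k \sum_l F (i, k, l).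
  rewrite (pair_bigA _ (fun i k => \sum_l F (i, k, l))).
  rewrite (pair_bigA _ (fun p l => F (p.1, p.2, l))) /=.
  by apply: eq_bigr => [[[i k] l]].
rewrite sum3 mulr_sumr; apply: eq_bigr => i _.
rewrite mulr_suml mulr_sumr; apply: eq_bigr => k _.
rewrite RE !mulr_suml mulr_sumr; apply: eq_bigr => l _.
have -> : h ^+ m = h ^+ skip1 k * h ^+ (m - skip1 k).
  by rewrite -exprD subnKC ?sk.
rewrite /e /= /pole.
by field; rewrite expf_neq0.
Qed.

Lemma plane_dependent (g : 'I_10 -> E) :
  (forall i, fraction_of plane_ring (g i)) ->
  exists c : 'I_10 -> E, [/\ forall i, fraction_of surface_ring (c i),
    exists i, c i != 0 & \sum_i c i * g i = 0].
Proof.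
move=> /(common_denominator plane_ring1 plane_ringM)[b [_ b0 /plane_dependent_ring]].
move=> [c [Rc c0 sumc]]; exists c; split=> //.
  by move=> i; apply: fraction_of_sub => //; apply: surface_ring1.
apply: (mulfI b0); rewrite mulr0 -[RHS]sumc mulr_sumr.
by apply: eq_bigr => i _; rewrite mulrCA.
Qed.

End Counting.

(** * Evaluation of polynomials in several variables *)

Section MpolyEvaluation.

Variables (n : nat) (k : fieldType).

Lemma eq_mmap (R : comNzRingType) (f f' : k -> R) (q q' : 'I_n -> R) p :
  f =1 f' -> q =1 q' -> mmap f q p = mmap f' q' p.
Proof.
move=> ff qq; apply: eq_bigr => m _; rewrite ff; congr (_ * _).
by apply: eq_bigr => i _; rewrite qq.
Qed.

Lemma rmorph_mmap (R R' : comNzRingType) (g : {rmorphism R -> R'}) (f : k -> R)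
    (q : 'I_n -> R) (p : {mpoly k[n]}) :
  g (mmap f q p) = mmap (g \o f) (g \o q) p.
Proof.
rewrite /mmap rmorph_sum; apply: eq_bigr => m _; rewrite rmorphM; congr (_ * _).
by rewrite rmorph_prod; apply: eq_bigr => i _; rewrite rmorphXn.
Qed.

Lemma mmap_homog (R : comNzRingType) (f : {rmorphism k -> R}) (q : 'I_n -> R)
    (mf : measure n) (wt : 'I_n -> nat) d p (a : R) :
  (forall m, mf m = (\sum_i wt i * m i)%N) -> p \is d.-homog for mf ->
  mmap f (fun i => a ^+ wt i * q i) p = a ^+ d * mmap f q p.
Proof.
move=> mfE /dhomogP hp; rewrite /mmap mulr_sumr big_seq [RHS]big_seq.
apply: eq_bigr => m /hp dm; rewrite mulrCA; congr (_ * _).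
rewrite /mmap1 -{}dm mfE -prodrXr -big_split; apply: eq_bigr => i _ /=.
by rewrite exprMn exprM.
Qed.

Lemma mmap_closed (R : comNzRingType) (f : k -> R) (q : 'I_n -> R) (A : R -> Prop) p :
  A 0 -> A 1 -> (forall y z, A y -> A z -> A (y + z)) ->
  (forall y z, A y -> A z -> A (y * z)) ->
  (forall c, A (f c)) -> (forall i, A (q i)) -> A (mmap f q p).
Proof.
move=> A0 A1 AD AM Af Aq.
have AX y j : A y -> A (y ^+ j).
  by move=> Ay; elim: j => [|j IH]; rewrite ?expr0 // exprS; apply: (AM).
apply: big_ind => // m _; apply: (AM) => //.
by apply: big_ind => // i _; apply: AX.
Qed.

Lemma mpoly_mmap (p : {mpoly k[n]}) : mmap (@mpolyC n k) (fun i => 'X_i) p = p.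
Proof.
rewrite [RHS]mpolyE; apply: eq_bigr => m _; rewrite mul_mpolyC; congr (_ *: _).
by rewrite mpolyXE_id.
Qed.

End MpolyEvaluation.

Definition vec4 (R : nmodType) (a b c d : R) (i : 'I_4) : R :=
  nth 0 [:: a; b; c; d] i.

Lemma vec4E (R : nmodType) (q : 'I_4 -> R) : q =1 vec4 (q 0) (q 1) (q 2) (q 3).
Proof.
by move=> [[|[|[|[|//]]]] lti]; congr q; apply: val_inj.
Qed.

(** The right-hand side of the equation of the surface in characteristic 5, in
    which 1/4 = -1. *)
Definition sextic_rhs (R : comNzRingType) (u v x : R) : R :=
  x ^+ 3 + u * v ^+ 2 * (3 * u - v) * x
  - u * v * (4 * v ^+ 4 - 23 * u * v ^+ 3 - 18 * u ^+ 2 * v ^+ 2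
             + u ^+ 3 * v - 4 * u ^+ 4).

(** Stated with a general c in the place of 1/4 so that the image of 1/4 need not
    be known; the last summand disappears when c is sent to -1. *)
Lemma rmorph_sextic_rhs (R R' : comNzRingType) (g : {rmorphism R -> R'}) c u v x y :
  g (y ^+ 2 - (x ^+ 3 + u * v ^+ 2 * (3 * u - v) * x
    + c * (u * v * (4 * v ^+ 4 - 23 * u * v ^+ 3 - 18 * u ^+ 2 * v ^+ 2
                    + u ^+ 3 * v - 4 * u ^+ 4)))) =
  g y ^+ 2 - (sextic_rhs (g u) (g v) (g x) + (g c + 1) * (g u * g v
    * (4 * g v ^+ 4 - 23 * g u * g v ^+ 3 - 18 * g u ^+ 2 * g v ^+ 2
       + g u ^+ 3 * g v - 4 * g u ^+ 4))).
Proof.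
rewrite !(rmorphXn, rmorph_nat, rmorphD, rmorphN, rmorphM) /sextic_rhs; ring.
Qed.

Lemma mmap_sextic (R : comNzRingType) (f : {rmorphism 'F_5 -> R}) (q : 'I_4 -> R) :
  mmap f q (sextic 'F_5) = q 3 ^+ 2 - sextic_rhs (q 0) (q 1) (q 2).
Proof.
pose g : {rmorphism {mpoly 'F_5[4]} -> R} := mmap f q.
have gX i : g 'X_i = q i by rewrite /g /= mmapX mmap1U.
have gC c : g c%:MP = f c by rewrite /g /= mmapC.
rewrite -[LHS]/(g _) /sextic -mul_mpolyC rmorph_sextic_rhs !gX gC.
rewrite (_ : 4^-1 = -1 :> 'F_5) ?rmorphN1 ?addNr ?mul0r ?addr0 //.
exact/eqP.
Qed.

Lemma sextic_rhsZ (R : comNzRingType) (a u v x : R) :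
  sextic_rhs (a * u) (a * v) (a ^+ 2 * x) = a ^+ 6 * sextic_rhs u v x.
Proof. by rewrite /sextic_rhs; ring. Qed.

(** * The forms defining the cover *)

Section CoverForms.

Variable R : comNzRingType.
Implicit Types x w y : R.

Definition numer_form x w y := - (x ^+ 3 + 3 * x * y ^+ 2 + 2 * w * y ^+ 2).
Definition denom_form x w y := w ^+ 3 - 2 * x * y ^+ 2 - y ^+ 3.

(** The homogeneous coordinates (x : w : y) followed by the coefficients of the
    member of the pencil through that point, with n / d for its parameter. *)
Definition cover_at x w y (n d : R) : seq R :=
  [:: x; w; y; d; n; 2 * n - 3 * d; -2 * d; n].

(** With v = d * hess, the ratios u / v, x / v^2, y / v^3 are 3 s, - X, 2 Y, where
    X and Y are formed with c = 1.  The signs make the model of [weierstrass]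
    match the surface: modulo 5 the substitution multiplies both Y^2 and X^3
    by -1. *)
Definition cover_u x w y (n d : R) : R := 3 * n * teval hess_terms (cover_at x w y n d).
Definition cover_v x w y (n d : R) : R := d * teval hess_terms (cover_at x w y n d).
Definition cover_x x w y (n d : R) : R := - teval theta_terms (cover_at x w y n d).
Definition cover_y x w y (n d : R) : R := 2 * teval jac_terms (cover_at x w y n d).

Lemma cover_sextic x w y : 5 = 0 :> R ->
  let n := numer_form x w y in let d := denom_form x w y in
  cover_y x w y n d ^+ 2
  = sextic_rhs (cover_u x w y n d) (cover_v x w y n d) (cover_x x w y n d).
Proof.
move=> five n d.
have := @covariant_syzygy5 R x w y d n (2 * n - 3 * d) (-2 * d) n five.
rewrite /cover_u /cover_v /cover_x /cover_y -/(cover_at x w y n d).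
have -> : cubic x w y d n (2 * n - 3 * d) (-2 * d) n = 0.
  by rewrite /cubic /n /d /numer_form /denom_form; ring.
move/(_ erefl); clearbody n d.
set j := teval jac_terms _; set t := teval theta_terms _.
set h := teval hess_terms _ => e.
rewrite exprMn e /sextic_rhs; apply/eqP; rewrite -subr_eq0; apply/eqP.
transitivity (5 * (t ^+ 3 + (9 * n * d ^+ 3 - n ^+ 2 * d ^+ 2) * t * h ^+ 4
  - (188 * n ^+ 5 * d + 11 * n ^+ 4 * d ^+ 2 + 54 * n ^+ 3 * d ^+ 3
     + 63 * n ^+ 2 * d ^+ 4 + 4 * n * d ^+ 5) * h ^+ 6)); first by ring.
by rewrite five mul0r.
Qed.

(** Used for two gradings, one by the coordinates of the point and one by the
    coefficients of the cubic. *)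
Lemma teval_scale (v : seq R) (l : seq term) (ds : seq nat) D a :
  size v = size ds ->
  all (fun '(Term _ e) => weight ds e == D) l ->
  teval l [seq a ^+ p.2 * p.1 | p <- zip v ds] = a ^+ D * teval l v.
Proof.
move=> sv; rewrite /teval; elim: l => [_|[z e] l IH /= /andP[/eqP eD /IH ->]].
  by rewrite mulr0.
rewrite mulrDr mulrCA; congr (_ * _ + _); rewrite -{}eD {l IH}.
elim: v ds e sv => [|y v IH] [|b ds] [|i e] //=; rewrite ?mulr1 ?expr0 //.
by case=> sv; rewrite IH // exprMn exprD -exprM mulnC; ring.
Qed.

End CoverForms.

Lemma dhomog_teval n (k : fieldType) (mf : measure n) (v : seq {mpoly k[n]})
    (ds : seq nat) D (l : seq term) :
  size v = size ds -> all2 (fun p e => p \is e.-homog for mf) v ds ->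
  all (fun '(Term _ e) => weight ds e == D) l ->
  teval l v \is D.-homog for mf.
Proof.
move=> sv hv; rewrite /teval; elim: l => [_|[z e] l IH /= /andP[/eqP eD /IH hl]].
  exact: dhomog0.
apply: rpredD hl; rewrite -[D]add0n; apply: dhomogM.
  have -> : integerR {mpoly k[n]} z = (integerR k z)%:MP.
    by rewrite (rmorph_integerR (@mpolyC n k)).
  by rewrite -mul_mpolyC mulr1 || rewrite -[_%:MP]mulr1 mul_mpolyC; apply/dhomogZ/dhomog1.
rewrite -{}eD {l IH}; elim: v ds e sv hv => [|p v IH] [|b ds] [|i e] //=;
  rewrite ?dhomog1 //.
by case=> sv /andP[hp hv]; apply: dhomogM; [rewrite mulnC; apply: dhomogMn | apply: IH].
Qed.

Lemma rmorph_cover_at (R R' : comNzRingType) (f : {rmorphism R -> R'}) x w y n d :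
  map f (cover_at x w y n d) = cover_at (f x) (f w) (f y) (f n) (f d).
Proof. by rewrite /cover_at /= rmorphB !rmorphM rmorphN !rmorph_nat. Qed.

(** * Affine coordinates on the plane *)

Notation R3 := {mpoly 'F_5[3]}.

(** An abstract embedding tf of F_5[X_0, X_1, X_2] into a field is used in the
    place of the field of fractions. *)
Section AffineChart.

Variables (E : fieldType) (tf : {rmorphism R3 -> E}).
Hypothesis tf_inj : forall p, tf p = 0 -> p = 0.

Definition scalar : {rmorphism 'F_5 -> E} := tf \o (@mpolyC 3 'F_5).
Definition aff_x : E := tf 'X_0 / tf 'X_2.
Definition aff_w : E := tf 'X_1 / tf 'X_2.
Local Notation iota := scalar.
Local Notation x := aff_x.
Local Notation w := aff_w.
Local Notation y := (tf 'X_2).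

Let ev : {rmorphism poly2 -> E} := ev2 iota w x.

Lemma tf_mmap p : tf p = mmap iota (fun i => tf 'X_i) p.
Proof. by rewrite -[in LHS](mpoly_mmap p) rmorph_mmap. Qed.

Lemma mpolyX_neq0 n (k : fieldType) (i : 'I_n) : 'X_i != 0 :> {mpoly k[n]}.
Proof. by rewrite -msupp_eq0 msuppX. Qed.

Lemma y_neq0 : y != 0.
Proof.
by apply/eqP => /tf_inj/eqP; apply/negP; apply: mpolyX_neq0.
Qed.

Definition chart (R : nmodType) (a b c : R) (i : 'I_3) : R :=
  nth 0 [:: a; b; c] i.

Lemma tf_chart i : tf 'X_i = y ^+ 1 * chart x w 1 i.
Proof.
have ord3 (j : 'I_3) : [\/ j = 0, j = 1 | j = 2].
  case: j => [[|[|[|//]]]] lt3; [constructor 1|constructor 2|constructor 3];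
    exact: val_inj.
rewrite expr1; case: (ord3 i) => -> /=; rewrite /chart /= ?mulr1 //.
- by rewrite mulrC divfK ?y_neq0.
- by rewrite mulrC divfK ?y_neq0.
Qed.

Lemma mdegE3 (m : 'X_{1..3}) : mdeg m = (\sum_i 1 * m i)%N.
Proof. by rewrite mdegE; apply: eq_bigr => i _; rewrite mul1n. Qed.

Lemma tf_homog d p : p \is d.-homog -> tf p = y ^+ d * mmap iota (chart x w 1) p.
Proof.
move=> hp; rewrite tf_mmap.
rewrite -(mmap_homog (wt := fun=> 1%N) iota (chart x w 1) _ mdegE3 hp).
by apply: eq_mmap => // i; rewrite tf_chart.
Qed.

Definition dehomog (p : R3) : poly2 := mmap (polyC \o polyC) (chart 'X 'X%:P 1) p.

Lemma ev_dehomog p : ev (dehomog p) = mmap iota (chart x w 1) p.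
Proof.
rewrite /dehomog rmorph_mmap; apply: eq_mmap => [c|i] /=; first exact: ev2CC.
case: i => [[|[|[|//]]]] lt3; rewrite /chart /=.
- exact: ev2Y.
- exact: ev2X.
- exact: (rmorph1 ev).
Qed.

Lemma dhomog_var (i : 'I_3) n : ('X_i ^+ n : R3) \is n.-homog.
Proof.
by rewrite -[X in X.-homog]mul1n; apply: dhomogMn; rewrite dhomogX /= mdeg1.
Qed.

Lemma homogenize (p : poly2) : exists d P,
  [/\ P \is d.-homog, tf P = y ^+ d * ev p & dehomog P = p].
Proof.
pose de : {rmorphism R3 -> poly2} := mmap (polyC \o polyC) (chart 'X 'X%:P 1).
have deX i : de 'X_i = chart 'X 'X%:P 1 i by rewrite /de /= mmapX mmap1U.
have deC c : de c%:MP = c%:P%:P by rewrite /de /= mmapC.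
pose good (p : poly2) := exists d P,
  [/\ P \is d.-homog, tf P = y ^+ d * ev p & de P = p].
have hX i : ('X_i : R3) \is 1.-homog := dhomog_var i 1.
have deY : de 'X_2 = 1 by rewrite deX.
have goodM p1 p2 : good p1 -> good p2 -> good (p1 * p2).
  move=> [d [P [hP tP dP]]] [d' [P' [hP' tP' dP']]].
  exists (d + d')%N, (P * P'); split; first exact: dhomogM.
    by rewrite !rmorphM tP tP' exprD; ring.
  by rewrite rmorphM dP dP'.
have goodD p1 p2 : good p1 -> good p2 -> good (p1 + p2).
  move=> [d [P [hP tP dP]]] [d' [P' [hP' tP' dP']]].
  exists (d + d')%N, (P * 'X_2 ^+ d' + P' * 'X_2 ^+ d); split.
  - by apply: rpredD; [|rewrite addnC]; apply: dhomogM => //; apply: dhomog_var.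
  - by rewrite !rmorphD !rmorphM !rmorphXn tP tP' exprD; ring.
  - by rewrite !rmorphD !rmorphM !rmorphXn deY dP dP' !expr1n !mulr1.
have evX : ev 'X = x by exact: ev2Y.
have evW : ev 'X%:P = w by exact: ev2X.
have evC c : ev c%:P%:P = iota c by exact: ev2CC.
have goodC c : good c%:P%:P.
  exists 0%N, c%:MP; split; last exact: deC.
    by rewrite -[_%:MP]mulr1 mul_mpolyC; apply/dhomogZ/dhomog1.
  by rewrite evC expr0 mul1r.
have goodX : good 'X.
  by exists 1%N, 'X_0; split; [exact: hX | rewrite evX tf_chart | rewrite deX].
have goodW : good 'X%:P.
  by exists 1%N, 'X_1; split; [exact: hX | rewrite evW tf_chart | rewrite deX].
have good1 (q : {poly 'F_5}) : good q%:P.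
  elim/poly_ind: q => [|q c IH]; first by rewrite -[0]polyC0; apply: goodC.
  by rewrite rmorphD rmorphM; apply/goodD/goodC/goodM.
elim/poly_ind: p => [|q c IH]; first by rewrite -(rmorph0 polyC); apply: good1.
by apply/goodD/good1/goodM.
Qed.

Lemma aff_indep p : ev2 iota w x p = 0 -> p = 0.
Proof.
move=> p0; have [d [P [_ tP <-]]] := homogenize p.
have -> : P = 0 by apply: tf_inj; rewrite tP [ev p]p0 mulr0.
by rewrite /dehomog /mmap msupp0 big_nil.
Qed.

Lemma plane_fractions z : (exists d A B,
    [/\ A \is d.-homog, B \is d.-homog, B != 0 & z = tf A / tf B]) <->
  fraction_of (plane_ring iota x w) z.
Proof.
split=> [[d [A [B [hA hB B0 ->]]]]|[_ [_ [[p ->] [q ->] q0 ->]]]].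
  exists (ev (dehomog A)), (ev (dehomog B)).
  have yd := expf_neq0 d y_neq0.
  have tB := tf_homog hB; split; try by eexists.
    by apply: contraNneq B0 => B0; rewrite (tf_inj (p := B)) // tB -ev_dehomog B0 mulr0.
  by rewrite (tf_homog hA) tB !ev_dehomog -mulf_div divff // mul1r.
have [d [P [hP tP _]]] := homogenize p; have [e [Q [hQ tQ _]]] := homogenize q.
exists (d + e)%N, (P * 'X_2 ^+ e), (Q * 'X_2 ^+ d); split.
- by apply: dhomogM => //; apply: dhomog_var.
- by rewrite addnC; apply: dhomogM => //; apply: dhomog_var.
- apply: contraNneq q0 => /(congr1 tf)/eqP; rewrite rmorphM rmorphXn tQ rmorph0.
  by rewrite !mulf_eq0 !expf_eq0 (negPf y_neq0) !andbF orbF /= => /eqP ->.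
- rewrite !rmorphM !rmorphXn tP tQ -/ev; have y0 := y_neq0.
  by field; rewrite q0 !expf_neq0.
Qed.

End AffineChart.

(** * Forms modulo the equation of the surface *)

Lemma rmorph_rhs (R R' : comNzRingType) (g : {rmorphism R -> R'}) u v x :
  g (sextic_rhs u v x) = sextic_rhs (g u) (g v) (g x).
Proof.
by rewrite /sextic_rhs !(rmorphXn, rmorph_nat, rmorphD, rmorphN, rmorphM).
Qed.

Notation R4 := {mpoly 'F_5[4]}.

Lemma dhomog_wvar (i : 'I_4) n : ('X_i ^+ n : R4) \is (n * wt i).-homog for wdeg.
Proof.
rewrite mulnC; apply: dhomogMn; rewrite dhomogX /= /wdeg (bigD1 i) //= big1.
  by rewrite mnm1E eqxx muln1 addn0.
by move=> j /negPf ne; rewrite mnm1E eq_sym ne muln0.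
Qed.

Lemma dhomogM_eq n (k : fieldType) (mf : measure n) d e f (p q : {mpoly k[n]}) :
  (d + e = f)%N -> p \is d.-homog for mf -> q \is e.-homog for mf ->
  p * q \is f.-homog for mf.
Proof. by move=> <-; apply: dhomogM. Qed.

Definition rhs_poly : R4 := sextic_rhs 'X_0 'X_1 'X_2.

Lemma rhs_polyE : rhs_poly = 'X_3 ^+ 2 - sextic 'F_5.
Proof.
rewrite -[sextic _ in RHS](mpoly_mmap (sextic 'F_5)) mmap_sextic.
by rewrite opprB addrC subrK.
Qed.

Lemma rhs_poly_homog : rhs_poly \is 6.-homog for wdeg.
Proof.
rewrite rhs_polyE; apply: rpredB; first exact: (dhomog_wvar 3 2).
exact: sextic_homog.
Qed.

(** Replacing y^2 by the right-hand side of the equation, monomial by monomial,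
    brings a form G to even_part + y * odd_part with y absent from both parts. *)
Section NormalForm.

Variables (d : nat) (G : R4).
Hypothesis hG : G \is d.-homog for wdeg.

Definition even_term (m : 'X_{1..4}) : R4 :=
  'X_0 ^+ m 0 * 'X_1 ^+ m 1 * 'X_2 ^+ m 2 * rhs_poly ^+ (m 3)./2.

Definition even_part : R4 :=
  \sum_(m <- msupp G | ~~ odd (m 3)) G@_m *: even_term m.
Definition odd_part : R4 :=
  \sum_(m <- msupp G | odd (m 3)) G@_m *: even_term m.

Lemma mmap1E4 (L : comNzRingType) (q : 'I_4 -> L) m :
  mmap1 q m = q 0 ^+ m 0 * q 1 ^+ m 1 * q 2 ^+ m 2 * q 3 ^+ m 3.
Proof.
have prod4 (F : 'I_4 -> L) : \prod_i F i = F 0 * F 1 * F 2 * F 3.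
  rewrite !big_ord_recl big_ord0 mulr1 !mulrA.
  by do ![congr (_ * _)]; congr (F _); apply: val_inj.
exact: (prod4 (fun i => q i ^+ m i)).
Qed.

Lemma wdegE4 m : wdeg m = (m 0%R + m 1%R + 2 * m 2%R + 3 * m 3%R)%N.
Proof.
rewrite /wdeg !big_ord_recl big_ord0 /= /wt /= addn0 !mul1n !addnA.
by do ![congr (_ + _)%N]; do ?congr (_ * _)%N; congr (m _); apply: val_inj.
Qed.

Lemma even_term_homog m :
  even_term m \is (m 0%R + m 1%R + 2 * m 2%R + 6 * (m 3%R)./2)%N.-homog for wdeg.
Proof.
rewrite /even_term; apply: dhomogM; last first.
  by apply: dhomogMn; apply: rhs_poly_homog.
apply: dhomogM; last by rewrite mulnC; apply: dhomog_wvar.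
by apply: dhomogM; rewrite -[X in X.-homog for _]muln1; apply: dhomog_wvar.
Qed.

Lemma even_part_homog : even_part \is d.-homog for wdeg.
Proof.
rewrite /even_part big_seq_cond; apply: rpred_sum => m /andP[mG ev3].
apply: dhomogZ; have := dhomog_mf hG mG; rewrite /= wdegE4 => <-.
have := even_term_homog m; rewrite (_ : (6 * _)%N = (3 * m 3%R)%N) //.
by have := odd_double_half (m 3); rewrite (negPf ev3); lia.
Qed.

Lemma odd_part_homog : odd_part \is (d - 3).-homog for wdeg.
Proof.
rewrite /odd_part big_seq_cond; apply: rpred_sum => m /andP[mG od3].
apply: dhomogZ; have := dhomog_mf hG mG; rewrite /= wdegE4 => <-.
have := even_term_homog m; have := odd_double_half (m 3); rewrite od3 => m3.
rewrite (_ : (_ + 6 * _)%N = (m 0%R + m 1%R + 2 * m 2%R + 3 * m 3%R - 3)%N) //; lia.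
Qed.

Lemma normal_form (L : comNzRingType) (f : {rmorphism 'F_5 -> L}) (q : 'I_4 -> L) :
  q 3 ^+ 2 = sextic_rhs (q 0) (q 1) (q 2) ->
  mmap f q G = mmap f (vec4 (q 0) (q 1) (q 2) 0) even_part
    + q 3 * mmap f (vec4 (q 0) (q 1) (q 2) 0) odd_part.
Proof.
move=> q3; pose g : {rmorphism R4 -> L} := mmap f (vec4 (q 0) (q 1) (q 2) 0).
have gX i : g 'X_i = vec4 (q 0) (q 1) (q 2) 0 i by rewrite /g /= mmapX mmap1U.
have gt m : g (even_term m)
    = q 0 ^+ m 0 * q 1 ^+ m 1 * q 2 ^+ m 2 * q 3 ^+ (m 3)./2.*2.
  rewrite /even_term !rmorphM !rmorphXn rmorph_rhs !gX /vec4 /= -q3.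
  by rewrite -exprM mul2n.
have gZ c p : g (c *: p) = f c * g p by rewrite /g /= mmapZ.
rewrite -[X in X + _]/(g _) -[X in _ + _ * X]/(g _) !rmorph_sum mulr_sumr.
rewrite /mmap (bigID (fun m : 'X_{1..4} => odd (m 3))) /= addrC.
congr (_ + _); apply: eq_bigr => m m3; rewrite gZ gt.
  by rewrite mmap1E4 -[in LHS](odd_double_half (m 3)) (negPf m3).
rewrite mmap1E4 -[in LHS](odd_double_half (m 3)) m3 exprD expr1; ring.
Qed.

End NormalForm.

(** The substitution u = 3 s, v = 1, x = - X performed by the cover up to scale. *)
Definition wdehomog (P : R4) : poly2 :=
  mmap (polyC \o polyC) (vec4 (3 * 'X%:P) 1 (- 'X) 0) P.

Lemma rmorph_vec4 (R R' : comNzRingType) (g : {rmorphism R -> R'}) a b c d :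
  g \o vec4 a b c d =1 vec4 (g a) (g b) (g c) (g d).
Proof. by move=> [[|[|[|[|//]]]] lti]. Qed.

Lemma ev_wdehomog (R : comNzRingType) (f : {rmorphism 'F_5 -> R}) t z P :
  ev2 f t z (wdehomog P) = mmap f (vec4 (3 * t) 1 (- z) 0) P.
Proof.
pose g : {rmorphism poly2 -> R} := ev2 f t z.
have gX : g 'X = z by exact: ev2Y.
have gT : g 'X%:P = t by exact: ev2X.
have gC c : g c%:P%:P = f c by exact: ev2CC.
rewrite -[LHS]/(g _); clearbody g; rewrite /wdehomog rmorph_mmap.
apply: eq_mmap => [c|i]; first exact: gC.
have gT3 : g (3 * 'X%:P) = 3 * t by rewrite rmorphM rmorph_nat gT.
have gXN : g (- 'X) = - z by rewrite rmorphN gX.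
case: i => [[|[|[|[|//]]]] lti].
- exact: gT3.
- exact: (rmorph1 g).
- exact: gXN.
- exact: (rmorph0 g).
Qed.

(** A form in u, v, x is determined by its restriction to v = 1.  At points with
    v different from 0 this is rescaling; a point with v = 0 is the specialisation
    of one with v an independent variable. *)
Lemma wdehomog_inj d P (L : fieldType) (f : {rmorphism 'F_5 -> L}) a b c :
  P \is d.-homog for wdeg -> wdehomog P = 0 -> mmap f (vec4 a b c 0) P = 0.
Proof.
move=> hP P0.
have chart (M : fieldType) (g : {rmorphism 'F_5 -> M}) a' b' c' : b' != 0 ->
    mmap g (vec4 a' b' c' 0) P = 0.
  move=> b0; have five : 5 = 0 :> M.
    by rewrite -(rmorph_nat g) (_ : 5 = 0 :> 'F_5) ?rmorph0 //; apply/eqP.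
  (* 3 * 2 = 1 modulo 5, so these are the values of s and X at the point. *)
  have := congr1 (ev2 g (2 * a' / b') (- c' / b' ^+ 2)) P0.
  rewrite ev_wdehomog rmorph0 => e.
  rewrite -[RHS](mulr0 (b' ^+ d)) -e.
  have wE m : wdeg m = (\sum_i wt i * m i)%N by [].
  rewrite -(mmap_homog (wt := wt) g _ _ wE hP).
  apply: eq_mmap => // i; rewrite vec4E /vec4 /=.
  have six : 6 = 1 :> M by rewrite -[RHS]addr0 -five; ring.
  case: i => [[|[|[|[|//]]]] lti] /=.
  - transitivity (6 * a'); first by rewrite six mul1r.
    by rewrite expr1; field.
  - by rewrite mulr1.
  - by field.
  - by rewrite mulr0.
pose tf := (@FracField.tofrac {poly L}).
pose g : {rmorphism 'F_5 -> {poly L}} := polyC \o f.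
have p0 : mmap g (vec4 a%:P 'X c%:P 0) P = 0.
  apply/eqP; rewrite -tofrac_eq0 -[X in X == _]/(tf _) /tf rmorph_mmap; apply/eqP.
  rewrite -[RHS](chart _ (tf \o g) (tf a%:P) (tf 'X) (tf c%:P)).
    by apply: eq_mmap => // i; rewrite rmorph_vec4 /= rmorph0.
  by rewrite /tf tofrac_eq0 polyX_eq0.
have := congr1 (horner_eval b) p0; rewrite rmorph_mmap => e.
transitivity (horner_eval b 0); last exact: horner0.
rewrite -[RHS]e.
apply: eq_mmap => [k|i] /=; first by rewrite /horner_eval hornerC.
case: i => [[|[|[|[|//]]]] lti]; rewrite /vec4 /= /horner_eval.
- by rewrite hornerC.
- by rewrite hornerX.
- by rewrite hornerC.
- by rewrite horner0.
Qed.

(** * The cover and its image *)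

Definition numer3 : R3 := numer_form 'X_0 'X_1 'X_2.
Definition denom3 : R3 := denom_form 'X_0 'X_1 'X_2.

Definition cover_poly : 4.-tuple R3 :=
  [tuple cover_u 'X_0 'X_1 'X_2 numer3 denom3; cover_v 'X_0 'X_1 'X_2 numer3 denom3;
         cover_x 'X_0 'X_1 'X_2 numer3 denom3; cover_y 'X_0 'X_1 'X_2 numer3 denom3].

Lemma tnth_cover i : tnth cover_poly i = vec4 (cover_u 'X_0 'X_1 'X_2 numer3 denom3)
  (cover_v 'X_0 'X_1 'X_2 numer3 denom3) (cover_x 'X_0 'X_1 'X_2 numer3 denom3)
  (cover_y 'X_0 'X_1 'X_2 numer3 denom3) i.
Proof. by rewrite (tnth_nth 0). Qed.

Lemma dhomog_nat n (k : fieldType) (mf : measure n) (c : nat) d (p : {mpoly k[n]}) :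
  p \is d.-homog for mf -> c%:R * p \is d.-homog for mf.
Proof. by move=> hp; rewrite -mpolyC_nat mul_mpolyC; apply: dhomogZ. Qed.

Lemma numer3_homog : numer3 \is 3.-homog.
Proof.
have X i k := dhomog_var i k.
rewrite /numer3 /numer_form rpredN !rpredD ?X //.
  by apply: (dhomogM_eq (d := 1) (e := 2)) (X 2 2) => //; apply/dhomog_nat/(X 0 1%N).
by apply: (dhomogM_eq (d := 1) (e := 2)) (X 2 2) => //; apply/dhomog_nat/(X 1 1%N).
Qed.

Lemma denom3_homog : denom3 \is 3.-homog.
Proof.
have X i k := dhomog_var i k.
rewrite /denom3 /denom_form !rpredB ?X //.
by apply: (dhomogM_eq (d := 1) (e := 2)) (X 2 2) => //; apply/dhomog_nat/(X 0 1%N).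
Qed.

Lemma cover_teval_homog l D :
  all (fun '(Term _ e) => weight [:: 1; 1; 1; 3; 3; 3; 3; 3]%N e == D) l ->
  teval l (cover_at 'X_0 'X_1 'X_2 numer3 denom3) \is D.-homog.
Proof.
apply: dhomog_teval => //=.
have X i := dhomog_var i 1; have hn := numer3_homog; have hd := denom3_homog.
rewrite !X hn hd /=; apply/and3P; split=> //.
  by apply: rpredB; apply: dhomog_nat.
by rewrite mulNr rpredN dhomog_nat.
Qed.

Lemma cover_homog i : tnth cover_poly i \is (15 * wt i).-homog.
Proof.
have hh : teval hess_terms (cover_at 'X_0 'X_1 'X_2 numer3 denom3) \is 12.-homog.
  exact: cover_teval_homog.
have ht : teval theta_terms (cover_at 'X_0 'X_1 'X_2 numer3 denom3) \is 30.-homog.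
  exact: cover_teval_homog.
have hj : teval jac_terms (cover_at 'X_0 'X_1 'X_2 numer3 denom3) \is 45.-homog.
  exact: cover_teval_homog.
rewrite tnth_cover; case: i => [[|[|[|[|//]]]] lti]; rewrite /vec4 /wt /=.
- by apply: (dhomogM_eq (d := 3)) hh => //; apply/dhomog_nat/numer3_homog.
- exact: (dhomogM_eq (d := 3)) denom3_homog hh.
- by rewrite /cover_x rpredN.
- exact: dhomog_nat.
Qed.

Section CoverInField.

Variables (E : fieldType) (tf : {rmorphism R3 -> E}).
Hypothesis tf_inj : forall p, tf p = 0 -> p = 0.

Local Notation iota := (scalar tf).
Local Notation x := (aff_x tf).
Local Notation w := (aff_w tf).
Local Notation y := (tf 'X_2).
Local Notation s := (param x w).
Local Notation X := (coordX x w).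
Local Notation Y := (coordY x w).

Let indep := aff_indep tf_inj.

Let xE : tf 'X_0 = y * x.
Proof. by rewrite mulrC divfK ?y_neq0. Qed.
Let wE : tf 'X_1 = y * w.
Proof. by rewrite mulrC divfK ?y_neq0. Qed.

Local Notation kappa := (tf denom3).

Lemma denom3E : kappa = y ^+ 3 * pencil_denom x w.
Proof.
rewrite /denom3 /denom_form !rmorphB !(rmorphM, rmorphXn, rmorph_nat) xE wE.
by rewrite /pencil_denom; ring.
Qed.

Lemma denom3_neq0 : kappa != 0.
Proof.
by rewrite denom3E mulf_neq0 ?expf_neq0 ?y_neq0 // (denom_neq0 indep).
Qed.

Lemma numer3E : tf numer3 = kappa * s.
Proof.
have p0 := denom_neq0 indep; rewrite denom3E /param.
transitivity (y ^+ 3 * pencil_numer x w); last by field.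
rewrite /numer3 /numer_form rmorphN !rmorphD !(rmorphM, rmorphXn, rmorph_nat) xE wE.
by rewrite /pencil_numer; ring.
Qed.

Lemma tf_cover_teval l a b :
  all (fun '(Term _ e) => weight [:: 1; 1; 1; 0; 0; 0; 0; 0]%N e == a) l ->
  all (fun '(Term _ e) => weight [:: 0; 0; 0; 1; 1; 1; 1; 1]%N e == b) l ->
  tf (teval l (cover_at 'X_0 'X_1 'X_2 numer3 denom3))
  = y ^+ a * kappa ^+ b * teval l (pencil_at s x w).
Proof.
move=> la lb; rewrite rmorph_teval -mulrA.
rewrite -(teval_scale _ (ds := [:: 0; 0; 0; 1; 1; 1; 1; 1]%N) _ lb) //.
rewrite -(teval_scale _ (ds := [:: 1; 1; 1; 0; 0; 0; 0; 0]%N) _ la) //.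
congr teval; rewrite rmorph_cover_at xE wE numer3E /cover_at /=.
rewrite !expr0 !expr1 !mul1r !mulr1.
do 5 congr cons; congr cons; [ring|congr cons; ring].
Qed.

Definition scale : E := tf (cover_v 'X_0 'X_1 'X_2 numer3 denom3).
Local Notation V := scale.
Local Notation h := (teval hess_terms (pencil_at s x w)).

Lemma scaleE : V = y ^+ 3 * kappa ^+ 4 * h.
Proof.
rewrite /scale /cover_v rmorphM (tf_cover_teval (a := 3) (b := 3)) //; ring.
Qed.

Lemma scale_neq0 : V != 0.
Proof.
by rewrite scaleE !mulf_neq0 ?expf_neq0 ?y_neq0 ?denom3_neq0 ?(hess_neq0 indep).
Qed.

(** The coordinates of the image of the generic point, rescaled to v = 1. *)
Definition cover_point := vec4 (3 * s) 1 (- X) (2 * Y).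

Lemma tf_cover i : tf (tnth cover_poly i) = V ^+ wt i * cover_point i.
Proof.
have h0 := hess_neq0 indep.
rewrite tnth_cover; case: i => [[|[|[|[|//]]]] lti];
  rewrite /cover_point /vec4 /wt /= ?expr1 ?mulr1 //.
- rewrite /scale /cover_u /cover_v !rmorphM rmorph_nat numer3E; ring.
- rewrite /cover_x rmorphN (tf_cover_teval (a := 6) (b := 8)) // scaleE.
  by rewrite /coordX; field.
- rewrite /cover_y rmorphM rmorph_nat (tf_cover_teval (a := 9) (b := 12)) // scaleE.
  by rewrite /coordY; field.
Qed.

Lemma tf_comp G : tf (G \mPo cover_poly) = mmap iota (fun i => tf (tnth cover_poly i)) G.
Proof. by rewrite /comp_mpoly rmorph_mmap; apply: eq_mmap. Qed.

Lemma tf_comp_homog d G : G \is d.-homog for wdeg ->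
  tf (G \mPo cover_poly) = V ^+ d * mmap iota cover_point G.
Proof.
move=> hG; have wtE m : wdeg m = (\sum_i wt i * m i)%N by [].
rewrite tf_comp -(mmap_homog (wt := wt) iota _ _ wtE hG).
by apply: eq_mmap => // i; rewrite tf_cover.
Qed.

Lemma cover_on_sextic : sextic 'F_5 \mPo cover_poly = 0.
Proof.
rewrite /comp_mpoly mmap_sextic !tnth_cover /vec4 /= cover_sextic ?subrr //.
by rewrite -mpolyC_nat (_ : 5 = 0 :> 'F_5) ?mpolyC0 //; apply/eqP.
Qed.

Lemma cover_point_sextic :
  cover_point 3 ^+ 2 = sextic_rhs (cover_point 0) (cover_point 1) (cover_point 2).
Proof.
have V0 := scale_neq0; apply: (mulfI (expf_neq0 6 V0)).
pose q i := tf (tnth cover_poly i).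
have q0 : mmap iota q (sextic 'F_5) = 0.
  by rewrite -tf_comp cover_on_sextic (rmorph0 tf).
have qE : q =1 fun i => V ^+ wt i * cover_point i := tf_cover.
clearbody q; move: (cover_point) (V) V0 qE => c v v0 qE.
move/eqP: q0; rewrite (mmap_sextic iota) !qE subr_eq0 => /eqP.
rewrite -[wt 0]/1%N -[wt 1]/1%N -[wt 2]/2%N -[wt 3]/3%N !expr1 sextic_rhsZ => <-.
by rewrite exprMn -exprM.
Qed.

Lemma cover_point_surface G : surface_ring iota x w (mmap iota cover_point G).
Proof.
have RC := surface_ringC iota x w.
have Rn n : surface_ring iota x w n%:R by rewrite -(rmorph_nat iota); apply: RC.
apply: mmap_closed => //; try exact: (Rn 0%N); try exact: (Rn 1%N).
- exact: surface_ringD.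
- exact: surface_ringM.
case=> [[|[|[|[|//]]]] lti]; rewrite /cover_point /vec4 /=.
- by apply: surface_ringM => //; apply: surface_ring_s.
- exact: (Rn 1%N).
- by apply: surface_ringN; apply: surface_ring_X.
- by apply: surface_ringM => //; apply: surface_ring_Y.
Qed.

(** The functions s, X, Y are 2 u / v, 4 x / v^2, 3 y / v^3 on the cover; the
    powers of v that equalise degrees evaluate to 1 at cover_point. *)
Lemma surface_homogenize z : surface_ring iota x w z ->
  exists d G, G \is d.-homog for wdeg /\ mmap iota cover_point G = z.
Proof.
pose g : {rmorphism R4 -> E} := mmap iota cover_point.
pose good z := exists d G, G \is d.-homog for wdeg /\ g G = z.
have gX i : g 'X_i = cover_point i by rewrite /g /= mmapX mmap1U.
have gC c : g c%:MP = iota c by rewrite /g /= mmapC.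
have goodM z1 z2 : good z1 -> good z2 -> good (z1 * z2).
  move=> [d [G [hG <-]]] [d' [G' [hG' <-]]]; exists (d + d')%N, (G * G').
  by rewrite rmorphM; split=> //; apply: dhomogM.
have goodD z1 z2 : good z1 -> good z2 -> good (z1 + z2).
  move=> [d [G [hG <-]]] [d' [G' [hG' <-]]].
  exists (d + d')%N, (G * 'X_1 ^+ d' + G' * 'X_1 ^+ d); split.
    have hX k : ('X_1 ^+ k : R4) \is k.-homog for wdeg.
      by rewrite -[X in X.-homog for _]muln1; apply: dhomog_wvar.
    by apply: rpredD; [|rewrite addnC]; apply: dhomogM.
  by rewrite rmorphD !rmorphM !rmorphXn gX /cover_point /vec4 /= !expr1n !mulr1.
have goodC c : good (iota c).
  exists 0%N, c%:MP; split; last exact: gC.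
  by rewrite -[_%:MP]mulr1 mul_mpolyC; apply/dhomogZ/dhomog1.
have goodZ (n : nat) i z1 : n%:R * cover_point i = z1 -> good z1.
  move=> <-; exists (wt i), (n%:R * 'X_i); split; last by rewrite rmorphM rmorph_nat gX.
  by apply: dhomog_nat; rewrite -[X in X.-homog for _]mul1n; apply: (dhomog_wvar i 1).
have five := five_field iota.
have goods : good s.
  apply: (goodZ 2%N 0); rewrite /cover_point /vec4 /=.
  by transitivity (s + 5 * s); [ring | rewrite five mul0r addr0].
have goodX : good X.
  apply: (goodZ 4%N 2); rewrite /cover_point /vec4 /=.
  by transitivity (X - 5 * X); [ring | rewrite five mul0r subr0].
have goodY : good Y.
  apply: (goodZ 3%N 3); rewrite /cover_point /vec4 /=.
  by transitivity (Y + 5 * Y); [ring | rewrite five mul0r addr0].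
have good1 (q : {poly 'F_5}) : good (ev1 iota s q).
  elim/poly_ind: q => [|q c IH]; first by rewrite rmorph0 -(rmorph0 iota); apply: goodC.
  by rewrite rmorphD rmorphM /= ev1X ev1C; apply/goodD/goodC/goodM.
have good2 (P : poly2) : good (ev2 iota s X P).
  elim/poly_ind: P => [|q c IH]; first by rewrite rmorph0 -(rmorph0 iota); apply: goodC.
  by rewrite rmorphD rmorphM /= ev2Y ev2C; apply: goodD => //; apply: goodM.
case=> P [Q ->]; exact: goodD (good2 P) (goodM _ _ goodY (good2 Q)).
Qed.

(** Injectivity of the restriction of functions from the surface to the plane.
    In normal form G restricts to P(s, X) + 2 Y Q(s, X), which vanishes only if
    P = Q = 0 ([ev_surface_eq0]); then G vanishes on the surface. *)
Lemma cover_vanish d G (L : fieldType) (f : {rmorphism 'F_5 -> L}) (q : 'I_4 -> L) :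
  G \is d.-homog for wdeg -> G \mPo cover_poly = 0 ->
  mmap f q (sextic 'F_5) = 0 -> mmap f q G = 0.
Proof.
move=> hG G0 /eqP; rewrite mmap_sextic subr_eq0 => /eqP qS.
have nf := normal_form G iota cover_point_sextic.
have e : mmap iota (vec4 (3 * s) 1 (- X) 0) (even_part G)
    + 2 * Y * mmap iota (vec4 (3 * s) 1 (- X) 0) (odd_part G) = 0.
  rewrite -[LHS]nf; apply: (mulfI (expf_neq0 d scale_neq0)).
  by rewrite -(tf_comp_homog hG) G0 mulr0 (rmorph0 tf).
move: e; rewrite -!ev_wdehomog => e.
have : ev_surface iota x w (wdehomog (even_part G)) (2 * wdehomog (odd_part G)) = 0.
  have evM (p : poly2) : ev2 iota s X (2 * p) = 2 * ev2 iota s X p.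
    by rewrite rmorphM rmorph_nat.
  by rewrite -[RHS]e /ev_surface /quad [X in _ + _ * X]evM mulrCA mulrA.
case/(ev_surface_eq0 indep) => ev0 od0.
have od1 : wdehomog (odd_part G) = 0.
  transitivity (3 * (2 * wdehomog (odd_part G)) - 5 * wdehomog (odd_part G)).
    by move: (wdehomog _) => P; ring.
  by rewrite od0 five_poly mulr0 mul0r subr0.
rewrite (normal_form G f qS) (wdehomog_inj f _ _ _ (even_part_homog hG) ev0).
by rewrite (wdehomog_inj f _ _ _ (odd_part_homog hG) od1) mulr0 addr0.
Qed.

End CoverInField.

Lemma divf_scale (F : fieldType) (v a b a' b' : F) :
  v != 0 -> a = v * a' -> b = v * b' -> a / b = a' / b'.
Proof. by move=> v0 -> ->; rewrite -mulf_div divff // mul1r. Qed.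

Section CoverImage.

Variables (E : fieldType) (tf : {rmorphism R3 -> E}).
Hypothesis tf_inj : forall p, tf p = 0 -> p = 0.

Lemma cover_v_neq0 : tnth cover_poly 1 != 0.
Proof.
apply/eqP => /(congr1 tf) /eqP; rewrite (tf_cover tf_inj) (rmorph0 tf).
by rewrite mulf_eq0 expf_eq0 (negPf (scale_neq0 tf_inj)) oner_eq0 andbF.
Qed.

(** In the converse direction, G is evaluated at the generic point of the image,
    which lies on the surface. *)
Lemma cover_vanishes_on d G : G \is d.-homog for wdeg ->
  G \mPo cover_poly = 0 <-> vanishes_on (sextic 'F_5) G.
Proof.
move=> hG; split=> [G0 L f q [_ qS] | vG]; first exact: (cover_vanish tf_inj hG G0 qS).
apply: tf_inj; rewrite tf_comp; apply: vG; split.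
  by exists 1; apply: contra_neq cover_v_neq0 => /tf_inj.
by rewrite -tf_comp cover_on_sextic (rmorph0 tf).
Qed.

Lemma cover_fractions z :
  (exists (d : nat) (G H : R4), [/\ G \is d.-homog for wdeg, H \is d.-homog for wdeg,
     ~ vanishes_on (sextic 'F_5) H
     & z = tf (G \mPo cover_poly) / tf (H \mPo cover_poly)]) <->
  fraction_of (surface_ring (scalar tf) (aff_x tf) (aff_w tf)) z.
Proof.
have V0 d := expf_neq0 d (scale_neq0 tf_inj); split.
  move=> [d [G [H [hG hH H0 ->]]]].
  exists (mmap (scalar tf) (cover_point tf) G), (mmap (scalar tf) (cover_point tf) H).
  split; last exact: divf_scale (V0 d) (tf_comp_homog tf_inj hG) (tf_comp_homog tf_inj hH).
  all: try exact: (cover_point_surface tf_inj).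
  apply: contra_not_neq H0 => e; apply/(cover_vanishes_on hH)/tf_inj.
  by rewrite (tf_comp_homog tf_inj hH) e mulr0.
move=> [a [b [/surface_homogenize [d [G [hG <-]]]]]].
move=> /surface_homogenize [e [H [hH <-]]] H0 ->.
have hX k : ('X_1 ^+ k : R4) \is k.-homog for wdeg.
  by rewrite -[X in X.-homog for _]muln1; apply: dhomog_wvar.
have hGX : G * 'X_1 ^+ e \is (d + e).-homog for wdeg by apply: dhomogM.
have hHX : H * 'X_1 ^+ d \is (d + e).-homog for wdeg by rewrite addnC; apply: dhomogM.
have evX F k : mmap (scalar tf) (cover_point tf) (F * 'X_1 ^+ k)
    = mmap (scalar tf) (cover_point tf) F.
  by rewrite rmorphM rmorphXn /= mmapX mmap1U /cover_point /vec4 /= expr1n mulr1.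
exists (d + e)%N, (G * 'X_1 ^+ e), (H * 'X_1 ^+ d); split=> //.
  move=> /(cover_vanishes_on hHX) /(congr1 tf) /eqP.
  rewrite (tf_comp_homog tf_inj hHX) evX (rmorph0 tf) mulf_eq0 (negPf (V0 _)) /=.
  by rewrite (negPf H0).
rewrite -[LHS](divf_scale (V0 (d + e)%N) erefl erefl).
congr (_ / _); first by rewrite (tf_comp_homog tf_inj hGX) evX.
by rewrite (tf_comp_homog tf_inj hHX) evX.
Qed.

End CoverImage.

(** * The rational map and its degree *)

Lemma tofrac_inj0 (p : R3) : FracField.tofrac p = 0 -> p = 0.
Proof. by move/eqP; rewrite tofrac_eq0 => /eqP. Qed.

Lemma cover_neq0 : exists i, tnth cover_poly i != 0.
Proof. by exists 1; apply: (cover_v_neq0 tofrac_inj0). Qed.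

Definition cover : ratmap S_F5 := @RatMap _ S_F5 15 cover_poly cover_homog cover_neq0 cover_on_sextic.

Lemma cover_dominant : dominant cover.
Proof.
move=> d G hG G_on; apply/(cover_vanishes_on tofrac_inj0 hG)/tofrac_inj0.
pose tf : {rmorphism R3 -> {fraction R3}} := @FracField.tofrac R3.
have tf_inj p : tf p = 0 -> p = 0 by apply: tofrac_inj0.
rewrite -[FracField.tofrac _]/(tf _) tf_comp.
have qE i : tf (tnth cover_poly i) = rm_eval cover (scalar tf) (fun j => tf 'X_j) i.
  by rewrite /rm_eval tf_mmap.
rewrite (eq_mmap G (fun=> erefl) qE); apply: G_on.
  by exists 0; apply/eqP => /tf_inj /eqP; apply/negP; exact: mpolyX_neq0.
have [i i0] := cover_neq0; exists i; rewrite -qE.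
by apply: contra_neq i0 => /tf_inj.
Qed.

Local Notation tofrac := (@FracField.tofrac R3 : {rmorphism R3 -> {fraction R3}}).

Lemma funfield_P2E :
  @funfield_P2 'F_5 = fraction_of (plane_ring (scalar tofrac) (aff_x tofrac) (aff_w tofrac)).
Proof.
apply: functional_extensionality => z; apply: propositional_extensionality.
exact: (plane_fractions tofrac_inj0).
Qed.

Lemma funfield_pullbackE : funfield_pullback cover
  = fraction_of (surface_ring (scalar tofrac) (aff_x tofrac) (aff_w tofrac)).
Proof.
apply: functional_extensionality => z; apply: propositional_extensionality.
exact: (cover_fractions tofrac_inj0).
Qed.

Theorem theorem1p5 :
  exists phi : ratmap S_F5,
    [/\ dominant phi, ratmap_separable phi & ratmap_degree phi 9].
Proof.
have indep := aff_indep tofrac_inj0.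
have free := @powers_free _ _ _ _ indep; have dep := @plane_dependent _ _ _ _ indep.
have pchar5 : 5%N \in [pchar {fraction R3}].
  by rewrite inE /= -(rmorph_nat (scalar tofrac)) (_ : 5 = 0 :> 'F_5) ?rmorph0 //; apply/eqP.
exists cover; rewrite /ratmap_separable /ratmap_degree funfield_P2E funfield_pullbackE.
move: (scalar _) (aff_x _) (aff_w _) indep free dep => iota x w indep free dep.
pose K0 := fraction_of (surface_ring iota x w).
pose K := fraction_of (plane_ring iota x w).
have R1 := surface_ring1 iota x w.
have RB := @surface_ringB _ iota x w.
have RM := @surface_ringM _ _ _ _ indep.
have P1 := plane_ring1 iota x w; have PM := @plane_ringM _ iota x w.
have K0_1 : K0 1 by exact: (fraction_of_sub R1).
have K0_B := fraction_ofB RB RM.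
have K0_V := fraction_ofV R1 RB RM.
have K_1 : K 1 by exact: (fraction_of_sub P1).
have K_M := fraction_ofM PM.
have Kb (i : 'I_9) : K (w ^+ i).
  have Kw : K w by apply: fraction_of_sub => //; exists 'X%:P; exact/esym/ev2X.
  by elim: (nat_of_ord i) => [|m IH]; rewrite ?expr0 ?exprS //; apply: K_M.
split.
- exact: cover_dominant.
- exact: (ext_separable_of_free K0_1 K0_B K0_V K_1 K_M Kb free dep pchar5).
- exact: (ext_degree_of_free K0_1 K0_B K0_V Kb free dep).
Qed.
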